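(* (Spectral gap.) Let $\beta>\alpha>0$, $\rho=\alpha/\beta<1$, and let $L\ge1$ be an integer. The operator $\mathcal K$ is bounded self-adjoint in $L_2(\pi)$. The least point $\gamma=\min S$ of the spectrum $S$ satisfies $0<\gamma\le\beta$. The solution $z_t=\mathrm e^{\mathcal Kt}z_0$ of $\dot z_t=\mathcal Kz_t$ in $L_2(\pi)$ satisfies $$\|z_t\|_{L_2(\pi)}\le\mathrm e^{-\gamma t}\|z_0\|_{L_2(\pi)},\qquad t\ge0.$$
   Context: When $L=1$, read $(L^k-L)/(L-1)$ as $k-1$. $\pi(k)=L^{k-1}\rho^{(L^k-L)/(L-1)}$, $k\ge1$. $L_2(\pi)=\{x\in\mathbb R^{\mathbb N}:x(0)=0,\ \|x\|^2_{L_2(\pi)}=\sum_{k\ge1}x(k)^2\pi(k)^{-1}<\infty\}$, with scalar product $(x,y)=\sum_{k\ge1}x(k)y(k)\pi(k)^{-1}$. $\mathcal K$ acts on sequences $x$ with $x(0)=0$ by $\mathcal Kx(0)=0$ and $\mathcal Kx(k)=\beta L\rho^{L^{k-1}}x(k-1)-(\beta L\rho^{L^k}+\beta)x(k)+\beta x(k+1)$, $k\ge1$. Spectrum (in the Karlin–McGregor sense): let $(Q_n)_{n\ge0}$ be the polynomials with $Q_0=0$, $Q_1=1$ and $-xQ_n(x)=\beta Q_{n-1}(x)-(\beta L\rho^{L^n}+\beta)Q_n(x)+\beta L\rho^{L^n}Q_{n+1}(x)$, $n\ge1$, and let $\psi$ be the probability measure on $\mathbb R_+$ for which $\int_0^\infty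 Q_i(x)Q_j(x)\psi(dx)=\mathbf 1_{i=j}\,\pi(i)^{-1}$, $i,j\ge1$. The spectrum $S$ is the support of $\psi$ (its points $x$ correspond to $-x$ being in the spectrum of $\mathcal K$). *)

(* Defs.v *)
From HB Require Import structures.
From mathcomp Require Import all_boot all_order all_algebra.
From mathcomp Require Import all_classical all_reals all_analysis.
From mathcomp Require Import ring.

Set Implicit Arguments.
Unset Strict Implicit.
Unset Printing Implicit Defensive.

Import Order.TTheory GRing.Theory Num.Theory.
Import numFieldNormedType.Exports.

Local Open Scope classical_set_scope.
Local Open Scope ring_scope.

Section Defs.
Context {R : realType}.
Implicit Types (x y w : nat -> R) (A : (nat -> R) -> nat -> R).

(* (L^k - L)/(L - 1), with the value k - 1 for L = 1.  For k >= 1 the natural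
   subtractions do not truncate and the quotient is exact. *)
Definition geom_exponent (L k : nat) : nat :=
  if L == 1%N then k.-1 else ((L ^ k - L) %/ (L - 1))%N.

(* Only the values at k >= 1 are ever used. *)
Definition weight (rho : R) (L k : nat) : R :=
  L%:R ^+ k.-1 * rho ^+ geom_exponent L k.

(* Hilbert space of sequences x with x 0 = 0, for a weight p on k >= 1.
   [L2_inner] and [L2_norm] are limits of real series, hence meaningful only
   on sequences satisfying [L2]. *)
Definition L2 (p : nat -> R) x : Prop :=
  x 0%N = 0 /\ cvgn (fun n => \sum_(1 <= k < n) x k ^+ 2 / p k).

Definition L2_inner (p : nat -> R) x y : R :=
  limn (fun n => \sum_(1 <= k < n) x k * y k / p k).

Definition L2_norm (p : nat -> R) x : R :=
  Num.sqrt (limn (fun n => \sum_(1 <= k < n) x k ^+ 2 / p k)).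

Definition L2_cvg (p : nat -> R) {T : Type} (F : set_system T)
    (u : T -> nat -> R) w : Prop :=
  [/\ L2 p w,
      \forall i \near F, L2 p (u i) &
      L2_norm p (fun k => u i k - w k) @[i --> F] --> (0 : R)].

Definition bounded_operator (p : nat -> R) A : Prop :=
  [/\ forall x, L2 p x -> L2 p (A x),
      forall (a : R) x y, L2 p x -> L2 p y ->
        A (fun k => a * x k + y k) = (fun k => a * A x k + A y k) &
      exists C : R, forall x, L2 p x -> L2_norm p (A x) <= C * L2_norm p x].

(* A^* = A; for everywhere defined operators there are no domain conditions. *)
Definition selfadjoint_operator (p : nat -> R) A : Prop :=
  forall x y, L2 p x -> L2 p y -> L2_inner p (A x) y = L2_inner p x (A y).

(* w = e^{tA} z0, the sum in L2 p of the exponential series. *)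
Definition is_exp_operator (p : nat -> R) A (t : R) (z0 : nat -> R) w : Prop :=
  L2_cvg p \oo
    (fun N k => \sum_(n < N) t ^+ n / n`!%:R * iter n A z0 k) w.

(* z : [0, +oo[ -> L2 p is differentiable in norm, with z' = A z and
   z 0 = z0; the derivative at t = 0 is one-sided, and the values of z at
   negative times are irrelevant. *)
Definition is_solution (p : nat -> R) A (z0 : nat -> R) (z : R -> nat -> R) : Prop :=
  [/\ z 0 = z0,
      forall t : R, 0 <= t -> L2 p (z t) &
      forall t : R, 0 <= t ->
        L2_cvg p (within [set h | 0 <= t + h] (0 : R)^')
          (fun h k => h^-1 * (z (t + h) k - z t k)) (A (z t))].

Definition opK (beta rho : R) (L : nat) x (k : nat) : R :=
  if k is k'.+1 then
    beta * L%:R * rho ^+ (L ^ k') * x k'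
    - (beta * L%:R * rho ^+ (L ^ k) + beta) * x k
    + beta * x k.+1
  else 0.

(* The three-term recurrence, solved for Q_{n+1}; see [KMpoly_rec]. *)
Fixpoint KMpoly (beta rho : R) (L n : nat) : {poly R} :=
  match n with
  | 0 => 0
  | n1.+1 =>
    match n1 with
    | 0 => 1
    | n2.+1 =>
      (beta * L%:R * rho ^+ (L ^ n1))^-1 *:
        (((beta * L%:R * rho ^+ (L ^ n1) + beta)%:P - 'X)
           * KMpoly beta rho L n1
         - beta *: KMpoly beta rho L n2)
    end
  end.

Lemma KMpoly_rec (beta rho : R) (L n : nat) :
  0 < beta -> 0 < rho -> (0 < L)%N -> (1 <= n)%N ->
  - ('X * KMpoly beta rho L n) =
    beta *: KMpoly beta rho L n.-1
    - (beta * L%:R * rho ^+ (L ^ n) + beta) *: KMpoly beta rho L n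
    + (beta * L%:R * rho ^+ (L ^ n)) *: KMpoly beta rho L n.+1.
Proof.
move=> b0 r0 L0; case: n => // n _.
have l0 : beta * L%:R * rho ^+ (L ^ n.+1) != 0.
  by rewrite !mulf_neq0 ?expf_neq0 ?gt_eqF ?ltr0n.
rewrite [KMpoly _ _ _ n.+2]/= scalerA divff // scale1r -!mul_polyC /=; ring.
Qed.

(* Probability measure on R_+ (as a measure on R that does not charge the
   negative half-line) for which the polynomials are orthogonal. *)
Definition KM_measure (beta rho : R) (L : nat)
    (psi : probability (measurableTypeR R) R) : Prop :=
  psi [set x : R | x < 0] = 0%E /\
  forall i j : nat, (1 <= i)%N -> (1 <= j)%N ->
    (\int[psi]_(x in [set x : R | (0 <= x)%R])
       ((KMpoly beta rho L i).[x] * (KMpoly beta rho L j).[x])%:E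
     = (if i == j then (weight rho L i)^-1 else 0)%:E)%E.

Definition measure_support (psi : probability (measurableTypeR R) R) : set R :=
  [set x : R | forall U : set R, open U -> U x -> (0 < psi U)%E].

Definition is_min (S : set R) (m : R) : Prop := S m /\ lbound S m.

End Defs.

(* Main.v *)
(* Writing y = x / pi, summation by parts gives
   -(K x, x) = beta * sum_k pi(k) (y(k) - y(k-1))^2 >= 0, and since the ratio
   r_k = pi(k+1)/pi(k) = L rho^(L^k) is eventually at most rho < 1, a discrete
   Hardy inequality yields -(K x, x) >= c |x|^2 for some c > 0.
   The polynomials Q_k carry this form to L_2(psi): for finitely supported x
   and f = sum_k x(k) Q_k one has int f^2 = |x|^2 and int t f^2 = -(K x, x).
   Hence bounds c <= -K <= d bound the moments of t - (c + d)/2 and, by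
   Chebyshev's inequality, psi does not charge ]-oo, c'[ for c' < c; conversely
   psi(]-oo, c[) = 0 gives -K >= c.  So gamma, the supremum of the c with
   psi(]-oo, c[) = 0, is the least point of the support, it is positive, and
   -K >= gamma.  Testing the form on y = 1 on {1, ..., n} shows gamma <= beta.
   Finally the derivative of e^(2 gamma t) |z_t|^2 is
   2 e^(2 gamma t) (gamma |z_t|^2 + (K z_t, z_t)) <= 0; the same argument with 0
   in place of gamma gives uniqueness. *)

Require Import Defs.
From HB Require Import structures.
From mathcomp Require Import all_boot all_order all_algebra.
From mathcomp Require Import all_classical all_reals all_analysis.
From mathcomp Require Import measurable_realfun.
From mathcomp Require Import ring lra.

Set Implicit Arguments.
Unset Strict Implicit.
Unset Printing Implicit Defensive.

Import Order.TTheory GRing.Theory Num.Theory.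
Import numFieldNormedType.Exports.

Local Open Scope classical_set_scope.
Local Open Scope ring_scope.

(** * Weighted square-summable sequences *)

Section L2Theory.
Context {R : realType} (p : nat -> R).
Hypothesis p_gt0 : forall k, 0 < p k.
Implicit Types x y z w : nat -> R.

Local Notation psum x y n := (\sum_(1 <= k < n) x k * y k / p k).
Local Notation "<| x , y |>" := (L2_inner p x y).

Lemma psum_nondecreasing x : nondecreasing_seq (fun n => psum x x n).
Proof.
apply/nondecreasing_seqP => n.
case: n => [|n]; first by rewrite !big_geq.
rewrite [leRHS]big_nat_recr //= lerDl mulr_ge0 ?invr_ge0 ?(ltW (p_gt0 _)) //.
by rewrite -expr2 sqr_ge0.
Qed.

Lemma L2E x : L2 p x = (x 0%N = 0 /\ cvgn (fun n => psum x x n)).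
Proof. by rewrite /L2; under eq_fun do under eq_bigr do rewrite expr2. Qed.

Lemma L2_normE x : L2_norm p x = Num.sqrt <|x, x|>.
Proof.
rewrite /L2_norm /L2_inner.
by under eq_fun do under eq_bigr do rewrite expr2.
Qed.

Lemma L2_bounded x (B : R) : x 0%N = 0 -> (forall n, psum x x n <= B) ->
  L2 p x /\ <|x, x|> <= B.
Proof.
move=> x0 xB.
have xc : cvgn (fun n => psum x x n).
  apply: nondecreasing_is_cvgn; first exact: psum_nondecreasing.
  by exists B => _ [n _ <-].
split; first by rewrite L2E.
by apply: limr_le => //; apply: nearW.
Qed.

Lemma bounded_L2 x (B : R) : x 0%N = 0 -> (forall n, psum x x n <= B) -> L2 p x.
Proof. by move=> x0 /(L2_bounded x0)[]. Qed.

Lemma psum_le x n : L2 p x -> psum x x n <= <|x, x|>.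
Proof.
rewrite L2E => -[_ xc].
exact: (nondecreasing_cvgn_le (psum_nondecreasing x) xc).
Qed.

Lemma L2_lin (a : R) x y : L2 p x -> L2 p y -> L2 p (fun k => a * x k + y k).
Proof.
move=> hx hy.
apply: (bounded_L2 (B := 2 * a ^+ 2 * <|x, x|> + 2 * <|y, y|>)) => [|n].
  by rewrite hx.1 hy.1 mulr0 addr0.
apply: (@le_trans _ _ (2 * a ^+ 2 * psum x x n + 2 * psum y y n)).
  rewrite !mulr_sumr -big_split /=; apply: ler_sum => k _.
  rewrite !mulrA -mulrDl ler_pM2r ?invr_gt0 //.
  rewrite -subr_ge0.
  rewrite [X in 0 <= X](_ : _ = (a * x k - y k) ^+ 2) ?sqr_ge0 //; ring.
by rewrite lerD // ler_wpM2l ?psum_le // mulr_ge0 // sqr_ge0.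
Qed.

Lemma L2_0 : L2 p (fun=> 0).
Proof.
apply: (bounded_L2 (B := 0)) => // n.
by rewrite big1 // => k _; rewrite mulr0 mul0r.
Qed.

Lemma L2_scale (a : R) x : L2 p x -> L2 p (fun k => a * x k).
Proof.
move=> hx; have := L2_lin a hx L2_0.
by under eq_fun do rewrite addr0.
Qed.

Lemma L2_add x y : L2 p x -> L2 p y -> L2 p (fun k => x k + y k).
Proof.
by move=> hx hy; have := L2_lin 1 hx hy; under eq_fun do rewrite mul1r.
Qed.

Lemma L2_sub x y : L2 p x -> L2 p y -> L2 p (fun k => x k - y k).
Proof.
move=> hx hy; have := L2_lin (-1) hy hx.
by under eq_fun do rewrite mulN1r addrC.
Qed.

Lemma L2_sum (u : nat -> nat -> R) N : (forall n, L2 p (u n)) ->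
  L2 p (fun k => \sum_(n < N) u n k).
Proof.
move=> hu; elim: N => [|N IH].
  by under eq_fun do rewrite big_ord0; exact: L2_0.
by under eq_fun do rewrite big_ord_recr; apply: L2_add.
Qed.

(** Polarization reduces mixed products to three convergent series of squares. This is what makes
    [L2_inner] a genuine limit rather than a default value of [limn]. *)
Lemma cvg_L2_inner x y : L2 p x -> L2 p y ->
  (fun n => psum x y n) @ \oo --> <|x, y|>.
Proof.
move=> hx hy; have hxy := L2_add hx hy.
suff : cvgn (fun n => psum x y n) by [].
have -> : (fun n => psum x y n) = (fun n => 2^-1 *
   (psum (fun k => x k + y k) (fun k => x k + y k) n - psum x x n - psum y y n)).
  apply/funext => n; rewrite -!sumrB mulr_sumr; apply: eq_bigr => k _; field.
  by rewrite gt_eqF.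
move: hx hy hxy; rewrite !L2E => -[_ hx] [_ hy] [_ hxy].
exact: (is_cvgMl_tmp (is_cvgB (is_cvgB hxy hx) hy)).
Qed.

Lemma L2_innerC x y : <|x, y|> = <|y, x|>.
Proof.
by congr (limn _); apply/funext => n; apply: eq_bigr => k _; rewrite [x k * _]mulrC.
Qed.

Lemma L2_inner0 x : <|x, fun=> 0|> = 0.
Proof.
rewrite /L2_inner; under eq_fun do under eq_bigr do rewrite mulr0 mul0r.
by under eq_fun do rewrite big1_eq; rewrite lim_cst.
Qed.

Lemma L2_inner_linl (a : R) x y z : L2 p x -> L2 p y -> L2 p z ->
  <|fun k => a * x k + y k, z|> = a * <|x, z|> + <|y, z|>.
Proof.
move=> hx hy hz; apply/cvg_lim => //.
have -> : (fun n => psum (fun k => a * x k + y k) z n) =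
          (fun n => a * psum x z n + psum y z n).
  apply/funext => n; rewrite mulr_sumr -big_split /=; apply: eq_bigr => k _; ring.
apply: cvgD; last exact: cvg_L2_inner.
by apply: cvgMl_tmp; exact: cvg_L2_inner.
Qed.

Lemma L2_inner_linr (a : R) x y z : L2 p x -> L2 p y -> L2 p z ->
  <|z, fun k => a * x k + y k|> = a * <|z, x|> + <|z, y|>.
Proof. by move=> *; rewrite L2_innerC L2_inner_linl // !(L2_innerC z). Qed.

Lemma L2_inner_ge0 x : L2 p x -> 0 <= <|x, x|>.
Proof. by move=> /(psum_le 0); rewrite big_geq. Qed.

Lemma L2_norm_sqr x : L2 p x -> L2_norm p x ^+ 2 = <|x, x|>.
Proof. by move=> hx; rewrite L2_normE sqr_sqrtr // L2_inner_ge0. Qed.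

Lemma L2_norm_ge0 x : 0 <= L2_norm p x.
Proof. by rewrite L2_normE sqrtr_ge0. Qed.

Lemma L2_norm_le x (B : R) : 0 <= B -> L2 p x -> <|x, x|> <= B ^+ 2 ->
  L2_norm p x <= B.
Proof.
by move=> B0 hx hB; rewrite -(ler_pXn2r (n := 2)) ?nnegrE ?L2_norm_ge0 ?L2_norm_sqr.
Qed.

Lemma L2_coord x k : L2 p x -> x k ^+ 2 <= p k * <|x, x|>.
Proof.
move=> hx; case: k => [|k].
  by rewrite hx.1 expr2 mul0r mulr_ge0 ?(ltW (p_gt0 _)) // L2_inner_ge0.
rewrite -ler_pdivrMl // mulrC; apply: le_trans (psum_le k.+2 hx).
rewrite big_nat_recr //= expr2 lerDr sumr_ge0 // => j _.
by rewrite mulr_ge0 ?invr_ge0 ?(ltW (p_gt0 _)) // -expr2 sqr_ge0.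
Qed.

Lemma L2_inner_eq0 x : L2 p x -> <|x, x|> = 0 -> x = fun=> 0.
Proof.
move=> hx x0; apply/funext => k; apply/eqP.
by rewrite -sqrf_eq0 eq_le sqr_ge0 andbT (le_trans (L2_coord k hx)) // x0 mulr0.
Qed.

Lemma L2_cauchy_schwarz x y : L2 p x -> L2 p y ->
  `|<|x, y|>| <= L2_norm p x * L2_norm p y.
Proof.
move=> hx hy.
have nx := L2_norm_sqr hx; have ny := L2_norm_sqr hy.
have [y0|y0] := eqVneq <|y, y|> 0.
  rewrite (L2_inner_eq0 hy y0) L2_inner0.
  by rewrite normr0 mulr_ge0 ?L2_norm_ge0.
have yp : 0 < <|y, y|> by rewrite lt_neqAle eq_sym y0 L2_inner_ge0.
rewrite -(ler_pXn2r (n := 2)) ?nnegrE ?mulr_ge0 ?L2_norm_ge0 //.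
rewrite exprMn nx ny real_normK ?num_real //.
(* Subtract from [x] its orthogonal projection onto [y]; the squared norm of the remainder is
   nonnegative. *)
have hz := L2_lin (- (<|x, y|> / <|y, y|>)) hy hx.
have := L2_inner_ge0 hz.
rewrite L2_inner_linl // !L2_inner_linr // (L2_innerC y x).
have -> : - (<|x, y|> / <|y, y|>) *
    (- (<|x, y|> / <|y, y|>) * <|y, y|> + <|x, y|>) +
    (- (<|x, y|> / <|y, y|>) * <|x, y|> + <|x, x|>) =
    (<|x, x|> * <|y, y|> - <|x, y|> ^+ 2) / <|y, y|> by field.
by rewrite pmulr_lge0 ?invr_gt0 // subr_ge0.
Qed.

Lemma L2_inner_lin2 (a : R) x y : L2 p x -> L2 p y ->
  <|fun k => a * x k + y k, fun k => a * x k + y k|> =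
  a ^+ 2 * <|x, x|> + 2 * a * <|x, y|> + <|y, y|>.
Proof.
move=> hx hy; have hz := L2_lin a hx hy.
rewrite L2_inner_linl // !L2_inner_linr // (L2_innerC y x); ring.
Qed.

Lemma L2_normZ (a : R) x : L2 p x -> L2_norm p (fun k => a * x k) = `|a| * L2_norm p x.
Proof.
move=> hx; rewrite !L2_normE.
have -> : <|fun k => a * x k, fun k => a * x k|> = a ^+ 2 * <|x, x|>.
  have := L2_inner_lin2 a hx L2_0; under eq_fun do rewrite addr0.
  by rewrite !L2_inner0 mulr0 !addr0 => ->.
by rewrite sqrtrM ?sqr_ge0 // sqrtr_sqr.
Qed.

Lemma L2_norm_lin (a : R) x y : L2 p x -> L2 p y ->
  L2_norm p (fun k => a * x k + y k) <= `|a| * L2_norm p x + L2_norm p y.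
Proof.
move=> hx hy; apply: L2_norm_le; last 1 first.
- rewrite L2_inner_lin2 // sqrrD exprMn !L2_norm_sqr // real_normK ?num_real //.
  rewrite lerD2r lerD2l -[leRHS]mulr_natl -!mulrA ler_pM2l //.
  apply: le_trans (ler_norm _) _; rewrite normrM ler_wpM2l //.
  exact: L2_cauchy_schwarz.
- by rewrite addr_ge0 ?mulr_ge0 ?L2_norm_ge0.
- exact: L2_lin.
Qed.

Lemma L2_norm_sum (u : nat -> nat -> R) N : (forall n, L2 p (u n)) ->
  L2_norm p (fun k => \sum_(n < N) u n k) <= \sum_(n < N) L2_norm p (u n).
Proof.
move=> hu; elim: N => [|N IH].
  under eq_fun do rewrite big_ord0.
  by rewrite big_ord0 L2_normE L2_inner0 sqrtr0.
rewrite big_ord_recr /=; under eq_fun do rewrite big_ord_recr /= -[X in X + _]mul1r.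
apply: le_trans (L2_norm_lin 1 _ (hu N)) _; first exact: L2_sum.
by rewrite normr1 mul1r lerD2r.
Qed.

(** A Fatou argument: each finite partial sum passes to the coordinatewise limit, and the bound does
    not depend on the cut-off. *)
Lemma L2_closed (S : nat -> nat -> R) w (B : R) : 0 <= B ->
  (forall N, L2 p (S N)) -> (forall N, L2_norm p (S N) <= B) ->
  (forall k, S ^~ k @ \oo --> w k) -> L2 p w /\ L2_norm p w <= B.
Proof.
move=> B0 hS SB Sw.
have [||hw hB] := @L2_bounded w (B ^+ 2).
- have := Sw 0%N; rewrite (_ : S ^~ 0%N = fun=> 0); last first.
    by apply/funext => N; exact: (hS N).1.
  by move=> /cvg_lim <- //; rewrite lim_cst.
- move=> n.
  have cv : (fun N => psum (S N) (S N) n) @ \oo --> psum w w n.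
    apply: cvg_big => [|k _]; first exact: add_continuous.
    by apply: cvgMr_tmp; apply: cvgM; exact: Sw.
  rewrite -(cvg_lim (@Rhausdorff R) cv); apply: limr_le; first by apply/cvg_ex; exists (psum w w n).
  apply: nearW => N; apply: le_trans (psum_le n (hS N)) _.
  by rewrite -L2_norm_sqr // lerXn2r ?nnegrE ?L2_norm_ge0.
by split => //; exact: L2_norm_le.
Qed.

Lemma L2_series (u : nat -> nat -> R) (b : nat -> R) w (B : R) :
  (forall n, L2 p (u n)) -> (forall n, L2_norm p (u n) <= b n) ->
  (fun N => \sum_(n < N) b n) @ \oo --> B ->
  (forall k, (fun N => \sum_(n < N) u n k) @ \oo --> w k) ->
  L2 p w /\ L2_norm p w <= B.
Proof.
move=> hu ub bB uw.
have b0 n : 0 <= b n by exact: le_trans (L2_norm_ge0 _) (ub n).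
have sB N : \sum_(n < N) b n <= B.
  rewrite -(cvg_lim (@Rhausdorff R) bB).
  apply: (@nondecreasing_cvgn_le _ (fun N => \sum_(n < N) b n)); last by apply/cvg_ex; exists B.
  by apply/nondecreasing_seqP => n; rewrite big_ord_recr /= lerDl.
apply: (L2_closed (S := fun N k => \sum_(n < N) u n k)) => //.
- by have := sB 0%N; rewrite big_ord0.
- by move=> N; exact: L2_sum.
- move=> N; apply: le_trans (L2_norm_sum _ hu) _.
  by apply: le_trans (sB N); apply: ler_sum => n _.
Qed.

(** Coordinates are controlled by the norm through [L2_coord], so a summable majorant of the norms
    gives absolute convergence in every coordinate. *)
Lemma L2_series_cvg (u : nat -> nat -> R) (b : nat -> R) (B : R) k :
  (forall n, L2 p (u n)) -> (forall n, L2_norm p (u n) <= b n) ->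
  (fun N => \sum_(n < N) b n) @ \oo --> B ->
  cvgn (fun N => \sum_(n < N) u n k).
Proof.
move=> hu ub bB.
have serE (v : nat -> R) : series v = (fun N => \sum_(n < N) v n).
  by apply/funext => N; rewrite seriesEord.
rewrite -(serE (u ^~ k)).
apply: normed_cvg.
apply: (@series_le_cvg _ _ (fun n => Num.sqrt (p k) * b n)) => [n|n|n|].
- exact: normr_ge0.
- by rewrite mulr_ge0 ?sqrtr_ge0 // (le_trans (L2_norm_ge0 _) (ub n)).
- apply: le_trans (ler_wpM2l (sqrtr_ge0 _) (ub n)).
  rewrite L2_normE -sqrtrM ?(ltW (p_gt0 _)) //.
  rewrite [leLHS](_ : _ = Num.sqrt (u n k ^+ 2)); last by rewrite sqrtr_sqr.
  by rewrite ler_wsqrtr // L2_coord.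
- rewrite serE; apply/cvg_ex; exists (Num.sqrt (p k) * B).
  by under eq_fun do rewrite -mulr_sumr; exact: cvgMl_tmp.
Qed.

Lemma L2_series_tail (u : nat -> nat -> R) (b : nat -> R) w (B : R) N :
  (forall n, L2 p (u n)) -> (forall n, L2_norm p (u n) <= b n) ->
  (fun N => \sum_(n < N) b n) @ \oo --> B ->
  (forall k, (fun N => \sum_(n < N) u n k) @ \oo --> w k) ->
  L2_norm p (fun k => w k - \sum_(n < N) u n k) <= B - \sum_(n < N) b n.
Proof.
move=> hu ub bB uw.
have tailE (v : nat -> R) l : (fun N => \sum_(n < N) v n) @ \oo --> l ->
    (fun M => \sum_(n < M) v (N + n)%N) @ \oo --> l - \sum_(n < N) v n.
  move=> vl.
  have -> : (fun M => \sum_(n < M) v (N + n)%N) =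
            (fun M => \sum_(n < M + N) v n - \sum_(n < N) v n).
    by apply/funext => M; rewrite addnC big_split_ord /= [X in X - _]addrC addrK.
  apply: cvgB; last exact: cvg_cst.
  by have := vl; rewrite -(cvg_shiftn N).
apply: (L2_series (u := fun n => u (N + n)%N) (b := fun n => b (N + n)%N) _ _ _ _).2 => //.
  exact: tailE.
by move=> k; exact: (tailE (u ^~ k)).
Qed.

End L2Theory.

(** * Boundedness and symmetry of the operator *)

Lemma cvgn_shiftS {R : realType} (u : nat -> R) (l : R) :
  u @ \oo --> l -> (fun n => u n.+1) @ \oo --> l.
Proof. by rewrite -cvg_shiftS. Qed.

(** A bound for the operator norm: [beta * (L + 1)] dominates every entry of the tridiagonal matrix
    in normalized coordinates, and there are three diagonals. *)
Definition opK_bound {R : realType} (beta : R) (L : nat) : R :=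
  3 * (beta * (L%:R + 1)).

Section Operator.
Context {R : realType} (beta rho : R) (L : nat).
Hypotheses (beta_gt0 : 0 < beta) (rho_gt0 : 0 < rho) (rho_lt1 : rho < 1).
Hypothesis L_gt0 : (0 < L)%N.
Implicit Types x y z w : nat -> R.

Local Notation p := (weight rho L).
Local Notation K := (opK beta rho L).
Local Notation r k := (L%:R * rho ^+ (L ^ k)).
Local Notation psum x y n := (\sum_(1 <= k < n) x k * y k / p k).
Local Notation "<| x , y |>" := (L2_inner p x y).

Lemma weight_gt0 k : 0 < p k.
Proof. by rewrite mulr_gt0 // exprn_gt0 // ltr0n. Qed.

Let p_neq0 k : p k != 0. Proof. by rewrite gt_eqF ?weight_gt0. Qed.

Let L_neq0 : L%:R != 0 :> R. Proof. by rewrite pnatr_eq0 -lt0n. Qed.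

Let rhoX_neq0 m : rho ^+ m != 0. Proof. by rewrite expf_neq0 ?gt_eqF. Qed.

Let neq0E := (p_neq0, L_neq0, rhoX_neq0).

(** The exponent is the geometric sum [L + ... + L^(k-1)], also for [L = 1]. The recurrence starts
    at index 1, since [weight] at 0 is a mere placeholder. It is the detailed balance behind the
    symmetry of [K]. *)
Lemma weight_recr k : p k.+2 = r k.+1 * p k.+1.
Proof.
have gS : geom_exponent L k.+2 = (geom_exponent L k.+1 + L ^ k.+1)%N.
  have gE j : geom_exponent L j.+1 = (\sum_(i < j) L ^ i.+1)%N.
    rewrite /geom_exponent; have [->|L1] := eqVneq L 1%N.
      by under eq_bigr do rewrite exp1n; rewrite sum1_card card_ord.
    have L2 : (0 < L.-1)%N by case: (L) L_gt0 L1 => [|[]].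
    have -> : (L ^ j.+1 - L = L * (L ^ j).-1)%N by rewrite -subn1 mulnBr muln1 expnS.
    rewrite predn_exp subn1 mulnCA mulKn //.
    by rewrite big_distrr; apply: eq_bigr => i _; rewrite expnS.
  by rewrite !gE big_ord_recr.
rewrite /weight gS /= exprD exprS; ring.
Qed.

Lemma ratio_ge0 k : 0 <= r k.
Proof. by rewrite mulr_ge0 ?exprn_ge0 // ltW. Qed.

Lemma ratio_le k : r k <= L%:R.
Proof. by rewrite ler_piMr // exprn_ile1 // ltW. Qed.

Lemma opK_lin (a : R) x y : K (fun k => a * x k + y k) = fun k => a * K x k + K y k.
Proof. by apply/funext => -[|k] /=; ring. Qed.

Lemma sum_shift (t : nat -> R) n : (forall k, 0 <= t k) -> t 0%N = 0 ->
  \sum_(0 <= k < n) t k <= \sum_(1 <= k < n) t k /\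
  \sum_(0 <= k < n) t k.+2 <= \sum_(1 <= k < n.+2) t k.
Proof.
move=> t_ge0 t0; split.
  case: n => [|n]; first by rewrite !big_geq.
  by rewrite big_ltn // t0 add0r.
by rewrite [leRHS]big_ltn // !big_add1 /= lerDr.
Qed.

(** Each term is compared with the weight of its own coordinate: by [weight_recr] the change of
    weight costs or gains a factor [r], which is at most [L]. The factor 3 comes from squaring a sum
    of three terms. *)
Lemma opK_sqr_le x k : x 0%N = 0 ->
  K x k.+1 * K x k.+1 / p k.+1 <= 3 * (beta * (L%:R + 1)) ^+ 2 *
    (x k * x k / p k + x k.+1 * x k.+1 / p k.+1 + x k.+2 * x k.+2 / p k.+2).
Proof.
move=> x0; pose M := (beta * (L%:R + 1)) ^+ 2.
have ML : beta ^+ 2 * L%:R <= M.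
  by rewrite /M exprMn ler_pM2l ?exprn_gt0 // sqrrD; have := ler0n R L; nra.
have Mr j : beta ^+ 2 * r j <= M.
  by apply: le_trans ML; rewrite ler_pM2l ?exprn_gt0 // ratio_le.
have t_ge0 j : 0 <= x j * x j / p j.
  by rewrite divr_ge0 ?(ltW (weight_gt0 _)) // -expr2 sqr_ge0.
have h1 : (beta * r k * x k) ^+ 2 / p k.+1 <= M * (x k * x k / p k).
  (* Index 0 is outside the scope of [weight_recr]; there the term vanishes because [x 0 = 0]. *)
  case: k => [|k]; first by rewrite x0 !mulr0 expr2 !mul0r mulr0.
  apply: le_trans (ler_wpM2r (t_ge0 _) (Mr k.+1)).
  rewrite weight_recr le_eqVlt; apply/orP; left; apply/eqP; field.
  by rewrite !neq0E.
have h2 : ((beta * r k.+1 + beta) * x k.+1) ^+ 2 / p k.+1 <=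
    M * (x k.+1 * x k.+1 / p k.+1).
  rewrite exprMn -(mulrA _ (x k.+1 ^+ 2)) [x k.+1 ^+ 2]expr2; apply: ler_wpM2r => //.
  rewrite /M lerXn2r ?nnegrE ?addr_ge0 ?mulr_ge0 ?exprn_ge0 ?(ltW beta_gt0) ?(ltW rho_gt0) //.
  by rewrite mulrDr mulr1 lerD2r ler_pM2l // ratio_le.
have h3 : (beta * x k.+2) ^+ 2 / p k.+1 <= M * (x k.+2 * x k.+2 / p k.+2).
  apply: le_trans (ler_wpM2r (t_ge0 _) (Mr k.+1)).
  rewrite weight_recr le_eqVlt; apply/orP; left; apply/eqP; field.
  by rewrite !neq0E.
rewrite -/M; apply: (@le_trans _ _ (3 * ((beta * r k * x k) ^+ 2 / p k.+1 +
  ((beta * r k.+1 + beta) * x k.+1) ^+ 2 / p k.+1 + (beta * x k.+2) ^+ 2 / p k.+1))).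
  rewrite -!mulrDl mulrA ler_pM2r ?invr_gt0 ?weight_gt0 //=.
  set u := _ * x k; set v := _ * x k.+1; set s := _ * x k.+2.
  have -> : beta * r k * x k = u by rewrite /u; ring.
  have -> : (beta * r k.+1 + beta) * x k.+1 = v by rewrite /v; ring.
  have := sqr_ge0 (u + v); have := sqr_ge0 (u - s); have := sqr_ge0 (v + s); nra.
by rewrite -(mulrA 3 M) ler_pM2l // 2!(mulrDr M) !lerD.
Qed.

Lemma opK_bounded x : L2 p x ->
  L2 p (K x) /\ L2_norm p (K x) <= opK_bound beta L * L2_norm p x.
Proof.
rewrite /opK_bound => hx; have x0 := hx.1.
have C0 : 0 <= 3 * (beta * (L%:R + 1)).
  by rewrite !mulr_ge0 ?addr_ge0 // ltW.
have t_ge0 j : 0 <= x j * x j / p j.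
  by rewrite divr_ge0 ?(ltW (weight_gt0 _)) // -expr2 sqr_ge0.
have [||hK KB] := @L2_bounded _ p weight_gt0 (K x) ((3 * (beta * (L%:R + 1))) ^+ 2 * <|x, x|>).
- by [].
(* One factor 3 is already in [opK_sqr_le]; the other counts the three shifted copies of the series,
   each at most [<|x, x|>]. *)
- move=> n; have Ctimes : (3 * (beta * (L%:R + 1))) ^+ 2 = 3 * (beta * (L%:R + 1)) ^+ 2 * 3.
    by ring.
  rewrite Ctimes -mulrA; case: n => [|n].
    rewrite big_geq //; apply: mulr_ge0; first by rewrite mulr_ge0 ?sqr_ge0.
    by apply: mulr_ge0 => //; exact: (L2_inner_ge0 weight_gt0 hx).
  rewrite big_add1 /=.
  apply: (le_trans (ler_sum _ (fun k _ => opK_sqr_le k x0))).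
  rewrite -mulr_sumr; apply: ler_wpM2l; first by rewrite mulr_ge0 ?sqr_ge0.
  rewrite !big_split /=.
  have [] := @sum_shift (fun k => x k * x k / p k) n t_ge0; first by rewrite x0 !mul0r.
  move=> h1 h3; have := @psum_le _ p weight_gt0 x n hx.
  have := @psum_le _ p weight_gt0 x n.+1 hx; rewrite big_add1 /=.
  have := @psum_le _ p weight_gt0 x n.+2 hx.
  lra.
- split=> //; apply: L2_norm_le => //; first exact: weight_gt0.
  + by rewrite mulr_ge0 // L2_norm_ge0.
  + by rewrite exprMn L2_norm_sqr //; exact: weight_gt0.
Qed.

Lemma L2_term_cvg0 x : L2 p x -> (fun n => x n * x n / p n) @ \oo --> (0 : R).
Proof.
move=> hx; have cx := cvg_L2_inner weight_gt0 hx hx.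
rewrite -cvg_shiftS /=.
have -> : (fun n => x n.+1 * x n.+1 / p n.+1) =
    (fun n => psum x x n.+2 - psum x x n.+1).
  by apply/funext => n; rewrite (big_nat_recr n.+1) //=; ring.
have c1 := cvgn_shiftS cx.
have := cvgB (cvgn_shiftS c1) c1; rewrite subrr; exact.
Qed.

(** The product is at most a sum of two squares; rescaled by [weight_recr], these are bounded by
    multiples of terms of convergent series. *)
Lemma L2_boundary_cvg0 x y : L2 p x -> L2 p y ->
  (fun n => x n.+1 * y n / p n) @ \oo --> (0 : R).
Proof.
move=> hx hy.
have b0 : (fun n => L%:R * (x n.+1 * x n.+1 / p n.+1) + y n * y n / p n) @ \oo --> (0 : R).
  have := cvgD (cvgMl_tmp (a := L%:R) (cvgn_shiftS (L2_term_cvg0 hx))) (L2_term_cvg0 hy).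
  rewrite mulr0 addr0; exact.
apply/norm_cvg0P.
apply: (squeeze_cvgr (f := fun=> 0) _ (cvg_cst 0) b0).
exists 1%N => // -[|n] //= _; rewrite normr_ge0 /=.
have pS := weight_gt0 n.+1.
apply: (@le_trans _ _ ((x n.+2 * x n.+2 + y n.+1 * y n.+1) / p n.+1)).
  rewrite normrM [X in _ * X]gtr0_norm ?invr_gt0 // ler_pM2r ?invr_gt0 //.
  rewrite ler_norml; have := sqr_ge0 (x n.+2 + y n.+1).
  have := sqr_ge0 (x n.+2 - y n.+1); have := sqr_ge0 (x n.+2); have := sqr_ge0 (y n.+1).
  by move=> *; apply/andP; split; nra.
rewrite mulrDl lerD2r weight_recr.
have rp : 0 < r n.+1 by rewrite mulr_gt0 ?exprn_gt0 ?ltr0n.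
have -> : x n.+2 * x n.+2 / p n.+1 = r n.+1 * (x n.+2 * x n.+2 / (r n.+1 * p n.+1)).
  by field; rewrite !neq0E.
apply: ler_wpM2r; last exact: ratio_le.
by rewrite divr_ge0 ?(ltW (mulr_gt0 rp pS)) // -expr2 sqr_ge0.
Qed.

(** Discrete Green formula: by detailed balance the off-diagonal products cancel in pairs, and only
    the edge crossing the cut-off remains. *)
Lemma opK_green x y n : x 0%N = 0 -> y 0%N = 0 ->
  psum (K x) y n.+1 - psum x (K y) n.+1 = beta * (x n.+1 * y n / p n - y n.+1 * x n / p n).
Proof.
move=> x0 y0; elim: n => [|n IH].
  by rewrite !big_geq // x0 y0 !mulr0 !mul0r !subrr mulr0.
rewrite !(big_nat_recr n.+1) //= opprD addrACA IH.
case: n {IH} => [|n]; first by rewrite x0 y0; field; rewrite !neq0E.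
rewrite weight_recr; field.
by rewrite !neq0E.
Qed.

Lemma opK_selfadjoint : selfadjoint_operator p K.
Proof.
move=> x y hx hy; have [hKx _] := opK_bounded hx; have [hKy _] := opK_bounded hy.
apply/eqP; rewrite -subr_eq0; apply/eqP.
have c1 : (fun n => psum (K x) y n.+1 - psum x (K y) n.+1) @ \oo --> <|K x, y|> - <|x, K y|>.
  exact: (cvgB (cvgn_shiftS (cvg_L2_inner weight_gt0 hKx hy))
               (cvgn_shiftS (cvg_L2_inner weight_gt0 hx hKy))).
have c2 : (fun n => psum (K x) y n.+1 - psum x (K y) n.+1) @ \oo --> (0 : R).
  under eq_fun do rewrite (opK_green _ hx.1 hy.1).
  have := cvgMl_tmp (a := beta) (cvgB (L2_boundary_cvg0 hx hy) (L2_boundary_cvg0 hy hx)).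
  rewrite subrr mulr0; exact.
by rewrite -(cvg_lim (@Rhausdorff R) c1) (cvg_lim (@Rhausdorff R) c2).
Qed.

End Operator.

(** * The exponential series *)

Section Evolution.
Context {R : realType} (beta rho : R) (L : nat).
Hypotheses (beta_gt0 : 0 < beta) (rho_gt0 : 0 < rho) (rho_lt1 : rho < 1).
Hypothesis L_gt0 : (0 < L)%N.
Implicit Types x y z w : nat -> R.

Local Notation p := (weight rho L).
Local Notation K := (opK beta rho L).
Local Notation "<| x , y |>" := (L2_inner p x y).
Local Notation C := (opK_bound beta L).

Let p_gt0 := weight_gt0 rho_gt0 L_gt0.
Let L2_K x : L2 p x -> L2 p (K x).
Proof. by move=> /(opK_bounded beta_gt0 rho_gt0 rho_lt1 L_gt0)[]. Qed.
Let C_ge0 : 0 <= C. Proof. by rewrite /opK_bound !mulr_ge0 ?addr_ge0 // ltW. Qed.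

(** Each coordinate of [K x] depends on at most three coordinates of [x]. *)
Lemma opK_cvg (S : nat -> nat -> R) w :
  (forall k, S ^~ k @ \oo --> w k) -> forall k, (fun N => K (S N) k) @ \oo --> K w k.
Proof.
move=> Sw [|k] /=; first exact: cvg_cst.
by apply: cvgD; [apply: cvgB|]; apply: cvgMl_tmp; exact: Sw.
Qed.

Lemma opK_sum (c : nat -> R) (v : nat -> nat -> R) N k :
  K (fun k => \sum_(n < N) c n * v n k) k = \sum_(n < N) c n * K (v n) k.
Proof.
elim: N k => [|N IH] k.
  by case: k => [|k] /=; rewrite ?big_ord0 // !mulr0 subrr addr0.
rewrite big_ord_recr /= -IH.
under [in LHS]eq_fun do rewrite big_ord_recr /= addrC.
by rewrite opK_lin addrC.
Qed.

Lemma L2_iter_opK x n : L2 p x ->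
  L2 p (iter n K x) /\ L2_norm p (iter n K x) <= C ^+ n * L2_norm p x.
Proof.
move=> hx; elim: n => [|n [IH1 IH2]]; first by rewrite mul1r.
have [h1 h2] := opK_bounded beta_gt0 rho_gt0 rho_lt1 L_gt0 IH1.
split=> //; apply: le_trans h2 _.
by rewrite exprS -(mulrA C) ler_wpM2l.
Qed.

Lemma cvg_expR (t : R) : (fun N => \sum_(n < N) t ^+ n / n`!%:R) @ \oo --> expR t.
Proof.
have -> : (fun N => \sum_(n < N) t ^+ n / n`!%:R) = series (exp_coeff t).
  by apply/funext => N; rewrite seriesEord.
exact: is_cvg_series_exp_coeff.
Qed.

(** A convex function lies above its tangents. The induction writes the excess for [n + 1] as [s]
    times the excess for [n] plus a nonnegative multiple of a square. *)
Lemma tangent_ge0 (s t : R) n : 0 <= s -> 0 <= t ->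
  0 <= s ^+ n - t ^+ n - n%:R * t ^+ n.-1 * (s - t).
Proof.
move=> s0 t0; elim: n => [|n IH]; first by rewrite !expr0 !mul0r !subrr.
have -> : s ^+ n.+1 - t ^+ n.+1 - n.+1%:R * t ^+ n.+1.-1 * (s - t) =
    s * (s ^+ n - t ^+ n - n%:R * t ^+ n.-1 * (s - t)) +
    n%:R * t ^+ n.-1 * (s - t) ^+ 2.
  case: n {IH} => [|n]; first by rewrite !expr1 !expr0; ring.
  by rewrite !succnK -[n.+2%:R]natr1 -[n.+1%:R]natr1 !exprS; ring.
by rewrite addr_ge0 // mulr_ge0 ?sqr_ge0 // mulr_ge0 ?exprn_ge0.
Qed.

Section Exp.
Variables (z0 : nat -> R) (hz0 : L2 p z0).

Let c (t : R) n := t ^+ n / n`!%:R.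
Let v n := iter n K z0.
Let b (t : R) n := c t n * (C ^+ n * L2_norm p z0).

Let hv n : L2 p (v n). Proof. exact: (L2_iter_opK n hz0).1. Qed.
Let vB n : L2_norm p (v n) <= C ^+ n * L2_norm p z0.
Proof. exact: (L2_iter_opK n hz0).2. Qed.

Let c_ge0 t n : 0 <= t -> 0 <= c t n.
Proof. by move=> t0; rewrite divr_ge0 ?exprn_ge0. Qed.

Let cvB (t : R) n : 0 <= t -> L2_norm p (fun k => c t n * v n k) <= b t n.
Proof.
move=> t0; rewrite (L2_normZ p_gt0) // ger0_norm ?c_ge0 //.
by rewrite ler_wpM2l ?c_ge0.
Qed.

Let sum_b t : (fun N => \sum_(n < N) b t n) @ \oo --> expR (t * C) * L2_norm p z0.
Proof.
have -> : (fun N => \sum_(n < N) b t n) =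
    (fun N => (\sum_(n < N) (t * C) ^+ n / n`!%:R) * L2_norm p z0).
  apply/funext => N; rewrite mulr_suml; apply: eq_bigr => n _.
  rewrite /b /c (exprMn _ t); ring.
by apply: cvgMr_tmp; exact: cvg_expR.
Qed.

(** The sum is taken coordinate by coordinate; convergence in norm is recovered in [expK_is_exp]
    from the scalar majorant [b]. *)
Definition expK t k := limn (fun N => \sum_(n < N) c t n * v n k).

Lemma cvg_expK t k : 0 <= t ->
  (fun N => \sum_(n < N) c t n * v n k) @ \oo --> expK t k.
Proof.
move=> t0.
apply: (L2_series_cvg p_gt0 (u := fun n k => c t n * v n k) _ _ (sum_b (t := t))).
  by move=> n; exact: L2_scale.
by move=> n; exact: cvB.
Qed.

Lemma L2_expK t : 0 <= t -> L2 p (expK t).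
Proof.
move=> t0.
apply: (L2_series p_gt0 (u := fun n k => c t n * v n k) _ _ (sum_b (t := t)) _).1.
- by move=> n; exact: L2_scale.
- by move=> n; exact: cvB.
- by move=> k; exact: cvg_expK.
Qed.

Lemma expK_is_exp t : 0 <= t -> is_exp_operator p K t z0 (expK t).
Proof.
move=> t0; split; first exact: L2_expK.
  by apply: nearW => N; apply: (L2_sum p_gt0 (u := fun n k => c t n * v n k)) => n; exact: L2_scale.
have b0 : (fun N => expR (t * C) * L2_norm p z0 - \sum_(n < N) b t n) @ \oo --> (0 : R).
  have := cvgB (cvg_cst (expR (t * C) * L2_norm p z0)) (sum_b (t := t)).
  rewrite subrr; exact.
apply: (squeeze_cvgr (f := fun=> 0) _ (cvg_cst 0) b0).
apply: nearW => N; rewrite L2_norm_ge0 /=.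
have -> : (fun k => \sum_(n < N) t ^+ n / n`!%:R * iter n K z0 k - expK t k) =
    (fun k => -1 * (expK t k - \sum_(n < N) c t n * v n k)).
  by apply/funext => k; rewrite mulN1r opprB.
rewrite (L2_normZ p_gt0) ?normrN1 ?mul1r; last first.
  apply: (L2_sub p_gt0); first exact: L2_expK.
  by apply: (L2_sum p_gt0 (u := fun n k => c t n * v n k)) => n; exact: L2_scale.
apply: (L2_series_tail p_gt0 (u := fun n k => c t n * v n k) N _ _ (sum_b (t := t))).
- by move=> n; exact: L2_scale.
- by move=> n; exact: cvB.
- by move=> k; exact: cvg_expK.
Qed.

(** Coefficients of the series differentiated term by term in [t]. They are those of [c] moved by
    one index, and moving [v] by one index is one application of [K]. *)
Let d (t : R) n := n%:R * t ^+ n.-1 / n`!%:R.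

Let d_recr t n : d t n.+1 = c t n.
Proof.
by rewrite /d /c factS natrM succnK -mulf_div divff ?mul1r // pnatr_eq0.
Qed.

Let sum_d (w : nat -> R) t (l : R) :
  (fun N => \sum_(n < N) c t n * w n.+1) @ \oo --> l ->
  (fun N => \sum_(n < N) d t n * w n) @ \oo --> l.
Proof.
move=> h; rewrite -cvg_shiftS /=; move: h; apply: cvg_trans; apply: near_eq_cvg.
apply: nearW => N; rewrite big_ord_recl /= /d !mul0r add0r.
by apply: eq_bigr => n _; rewrite /bump /= add1n -/(d t n.+1) d_recr.
Qed.

Let cvg_K_expK t k : 0 <= t ->
  (fun N => \sum_(n < N) d t n * v n k) @ \oo --> K (expK t) k.
Proof.
move=> t0; apply: (@sum_d (fun n => v n k)).
have := @opK_cvg (fun N k => \sum_(n < N) c t n * v n k) (expK t) (fun j => @cvg_expK t j t0) k.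
apply: cvg_trans; apply: near_eq_cvg; apply: nearW => N.
by rewrite (opK_sum (c t)).
Qed.

(* By convexity of [t ^+ n] the coefficients of the remainder are nonnegative,
   so its norm is bounded by the same remainder for the scalar exponential. *)
Lemma expK_taylor s t : 0 <= s -> 0 <= t ->
  L2_norm p (fun k => expK s k - expK t k - (s - t) * K (expK t) k) <=
  (expR (s * C) - expR (t * C) - (s - t) * (C * expR (t * C))) * L2_norm p z0.
Proof.
move=> s0 t0; pose e n := c s n - c t n - (s - t) * d t n.
have eE n : e n = (s ^+ n - t ^+ n - n%:R * t ^+ n.-1 * (s - t)) / n`!%:R.
  rewrite /e /c /d; ring.
have e_ge0 n : 0 <= e n by rewrite eE divr_ge0 // tangent_ge0.
have sumE (w : nat -> R) N : \sum_(n < N) e n * w n = \sum_(n < N) c s n * w n -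
    \sum_(n < N) c t n * w n - (s - t) * \sum_(n < N) d t n * w n.
  rewrite mulr_sumr -!sumrB; apply: eq_bigr => n _; rewrite /e; ring.
apply: (L2_series p_gt0 (u := fun n k => e n * v n k)
  (b := fun n => e n * (C ^+ n * L2_norm p z0)) _ _ _ _).2 => [n|n||k].
- exact: L2_scale.
- by rewrite (L2_normZ p_gt0) // ger0_norm // ler_wpM2l.
- under eq_fun do rewrite (sumE (fun n => C ^+ n * L2_norm p z0)).
  have -> : (expR (s * C) - expR (t * C) - (s - t) * (C * expR (t * C))) * L2_norm p z0 =
      expR (s * C) * L2_norm p z0 - expR (t * C) * L2_norm p z0 -
      (s - t) * (C * (expR (t * C) * L2_norm p z0)) by ring.
  apply: cvgB; first by apply: cvgB; exact: sum_b.
  apply: cvgMl_tmp; apply: (@sum_d (fun n => C ^+ n * L2_norm p z0)).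
  have -> : (fun N => \sum_(n < N) c t n * (C ^+ n.+1 * L2_norm p z0)) =
      (fun N => C * \sum_(n < N) b t n).
    by apply/funext => N; rewrite mulr_sumr; apply: eq_bigr => n _; rewrite /b exprS; ring.
  by apply: cvgMl_tmp; exact: sum_b.
- under eq_fun do rewrite (sumE (fun n => v n k)).
  apply: cvgB; first by apply: cvgB; exact: cvg_expK.
  by apply: cvgMl_tmp; exact: cvg_K_expK.
Qed.

Lemma expK_solution : is_solution p K z0 expK.
Proof.
split; first last.
- move=> t t0; split; first exact/L2_K/L2_expK.
    rewrite near_withinE; apply: nearW => h th.
    by apply: L2_scale => //; apply: L2_sub => //; apply: L2_expK.
  (* The bound of [expK_taylor] divided by [h]: up to a constant, the defect of the difference
     quotient of the scalar function [expR (s * C)] at [t]. *)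
  pose g h := L2_norm p z0 * (h^-1 * (expR ((t + h) * C) - expR (t * C)) - C * expR (t * C)).
  have g0 : g h @[h --> (0 : R)^'] --> (0 : R).
    have dE : is_derive t (1 : R) (fun s => expR (s * C)) (C * expR (t * C)).
      apply: is_derive_eq; rewrite /GRing.scale /=; ring.
    have hc : h^-1 * (expR ((t + h) * C) - expR (t * C)) @[h --> (0 : R)^'] -->
        C * expR (t * C).
      rewrite -(@derive_val _ _ _ _ _ _ _ dE) /derive.
      apply: cvg_trans (@ex_derive _ _ _ _ _ _ _ dE).
      apply: near_eq_cvg; apply: nearW => h /=.
      by rewrite /GRing.scale /= mulr1 (addrC h).
    have := cvgMl_tmp (a := L2_norm p z0) (cvgB hc (cvg_cst (C * expR (t * C)))).
    rewrite subrr mulr0; exact.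
  have ng0 : `|g h| @[h --> within [set h | 0 <= t + h] (0 : R)^'] --> (0 : R).
    by apply/norm_cvg0P; exact: cvg_within_filter.
  apply: (squeeze_cvgr (f := fun=> 0) _ (cvg_cst 0) ng0).
  rewrite near_withinE; near=> h => th; rewrite L2_norm_ge0 /=.
  have h0 : h != 0 by near: h; exact: nbhs_dnbhs_neq.
  have -> : (fun k => h^-1 * (expK (t + h) k - expK t k) - K (expK t) k) =
      (fun k => h^-1 * (expK (t + h) k - expK t k - (t + h - t) * K (expK t) k)).
    by apply/funext => k; field.
  rewrite (L2_normZ p_gt0); last first.
    apply: L2_sub => //; first by apply: L2_sub => //; exact: L2_expK.
    by apply: L2_scale => //; exact/L2_K/L2_expK.
  apply: le_trans (ler_wpM2l (normr_ge0 _) (expK_taylor th t0)) _.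
  apply: le_trans (ler_wpM2l (normr_ge0 _) (ler_norm _)) _.
  rewrite -normrM [leLHS](_ : _ = `|g h|) //; congr (`|_|); rewrite /g; field.
  exact: h0.
- exact: L2_expK.
- apply/funext => k; apply/cvg_lim => //; rewrite -cvg_shiftS /=.
  have -> : (fun N => \sum_(n < N.+1) c 0 n * v n k) = (fun=> z0 k); last exact: cvg_cst.
  apply/funext => N; rewrite big_ord_recl big1 /= => [|n _].
    by rewrite /c expr0 fact0 divr1 mul1r addr0.
  by rewrite /c exprS mul0r !mul0r.
Unshelve. all: by end_near. Qed.

End Exp.

End Evolution.

(** * Energy decay *)

Section Decay.
Context {R : realType} (beta rho : R) (L : nat).
Hypotheses (beta_gt0 : 0 < beta) (rho_gt0 : 0 < rho) (rho_lt1 : rho < 1).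
Hypothesis L_gt0 : (0 < L)%N.
Implicit Types x y w : nat -> R.

Local Notation p := (weight rho L).
Local Notation K := (opK beta rho L).
Local Notation "<| x , y |>" := (L2_inner p x y).
Local Notation psum x y n := (\sum_(1 <= k < n) x k * y k / p k).

Let p_gt0 := weight_gt0 rho_gt0 L_gt0.
Let p_neq0 k : p k != 0. Proof. by rewrite gt_eqF. Qed.
Let L2_K x : L2 p x -> L2 p (K x).
Proof. by move=> /(opK_bounded beta_gt0 rho_gt0 rho_lt1 L_gt0)[]. Qed.

(** The operator inequality [-K >= c], tested on finitely supported sequences only: these are the
    ones that correspond to polynomials in L_2(psi). [form_geL2] extends it to the whole space. *)
Definition form_ge (c : R) := forall x n, x 0%N = 0 ->
  (forall k, (n <= k)%N -> x k = 0) -> c * psum x x n <= - psum (K x) x n.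

Lemma form_geL2 c x : form_ge c -> L2 p x -> c * <|x, x|> <= - <|K x, x|>.
Proof.
move=> hc hx; have x0 := hx.1.
pose tr n k := if (k < n)%N then x k else 0.
have xx n : psum (tr n) (tr n) n = psum x x n.
  by apply: eq_big_nat => k /andP[_ kn]; rewrite /tr kn.
(* Truncation cuts the edge between [n] and [n + 1]; its cost is a boundary term that tends to 0. *)
have Kx n : psum (K (tr n.+1)) (tr n.+1) n.+1 =
    psum (K x) x n.+1 - beta * (x n.+1 * x n / p n).
  case: n => [|n]; first by rewrite !big_geq // x0 mulr0 mul0r mulr0 subrr.
  rewrite [in RHS]big_nat_recr // [LHS]big_nat_recr //=.
  rewrite (@eq_big_nat _ _ _ _ _ _ (fun k => K x k * x k / p k)); last first.
    move=> [|k] // /andP[_ kn]; rewrite /tr /=.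
    by rewrite (leqW (ltnW kn)) (leqW kn) (kn : (k.+2 < n.+2)%N).
  rewrite /tr !ltnS !leqnn leqnSn ltnn; field; exact: p_neq0.
have c1 : (fun n => c * psum x x n.+1) @ \oo --> c * <|x, x|>.
  by apply: cvgMl_tmp; exact: (cvgn_shiftS (cvg_L2_inner p_gt0 hx hx)).
have c2 : (fun n => - (psum (K x) x n.+1 - beta * (x n.+1 * x n / p n))) @ \oo --> - <|K x, x|>.
  apply: cvgN.
  have := cvgB (cvgn_shiftS (cvg_L2_inner p_gt0 (L2_K hx) hx))
    (cvgMl_tmp (a := beta) (L2_boundary_cvg0 rho_gt0 rho_lt1 L_gt0 hx hx)).
  by rewrite mulr0 subr0; exact.
rewrite -(cvg_lim (@Rhausdorff R) c1) -(cvg_lim (@Rhausdorff R) c2).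
apply: ler_lim; [by apply/cvg_ex; exists (c * <|x, x|>) | by apply/cvg_ex; exists (- <|K x, x|>)|].
apply: nearW => n; rewrite -Kx -xx; apply: hc; first by rewrite /tr /= x0.
by move=> k nk; rewrite /tr ltnNge nk.
Qed.

Lemma solution_derive (z0 : nat -> R) (z : R -> nat -> R) (t : R) :
  is_solution p K z0 z -> 0 <= t ->
  h^-1 * (<|z (t + h), z (t + h)|> - <|z t, z t|>)
    @[h --> within [set h | 0 <= t + h] (0 : R)^'] --> 2 * <|K (z t), z t|>.
Proof.
move=> [_ hz dz] t0; have [hK _ cK] := dz t t0.
pose q (h : R) k := h^-1 * (z (t + h) k - z t k).
pose e (h : R) := L2_norm p (fun k => q h k - K (z t) k).
(* With [z (t + h) = z t + h q], the error of the difference quotient is, up to sign,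
   [h <q, q> + 2 <q - K z, z>]. [B] bounds it by the triangle and Cauchy-Schwarz inequalities. *)
pose B h := `|h| * (e h + L2_norm p (K (z t))) ^+ 2 + 2 * (e h * L2_norm p (z t)).
have cB : B h @[h --> within [set h | 0 <= t + h] (0 : R)^'] --> (0 : R).
  have h0 : `|h| @[h --> within [set h | 0 <= t + h] (0 : R)^'] --> (0 : R).
    apply/norm_cvg0P; apply: cvg_within_filter; exact: nbhs_dnbhs.
  have h2 : (e h + L2_norm p (K (z t))) ^+ 2
      @[h --> within [set h | 0 <= t + h] (0 : R)^'] --> (0 + L2_norm p (K (z t))) ^+ 2.
    rewrite expr2; under eq_fun do rewrite expr2.
    by apply: cvgM; apply: (cvgD cK (cvg_cst _)).
  have := cvgD (cvgM h0 h2) (cvgMl_tmp (a := 2) (cvgMr_tmp (b := L2_norm p (z t)) cK)).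
  by rewrite !mul0r mulr0 addr0; exact.
apply/cvgrPdist_le => eps eps0.
move/cvgr0Pnorm_le : cB => /(_ _ eps0).
rewrite near_withinE => hB; rewrite near_withinE; near=> h => th.
have hne : h != 0 by near: h; exact: nbhs_dnbhs_neq.
have hBh : `|B h| <= eps by move: th; near: h; exact: hB.
apply: le_trans hBh; apply: le_trans (ler_norm _).
have hq : L2 p (q h) by apply: L2_scale => //; apply: L2_sub => //; exact: hz.
have hv : L2 p (fun k => q h k - K (z t) k) by exact: L2_sub.
have -> : z (t + h) = (fun k => h * q h k + z t k).
  by apply/funext => k; rewrite /q; field.
have hzt := hz t t0.
rewrite (L2_inner_lin2 p_gt0) //.
have qv : q h = (fun k => 1 * (q h k - K (z t) k) + K (z t) k).
  by apply/funext => k; ring.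
have -> : 2 * <|K (z t), z t|> - h^-1 *
    (h ^+ 2 * <|q h, q h|> + 2 * h * <|q h, z t|> + <|z t, z t|> - <|z t, z t|>) =
   - (h * <|q h, q h|> + 2 * <|fun k => q h k - K (z t) k, z t|>).
  rewrite [in <|q h, z t|>]qv (L2_inner_linl p_gt0) //; field.
  exact: hne.
rewrite normrN; apply: le_trans (ler_normD _ _) _; apply: lerD.
  rewrite normrM; apply: ler_wpM2l => //.
  rewrite ger0_norm ?(L2_inner_ge0 p_gt0) // -(L2_norm_sqr p_gt0) //.
  rewrite lerXn2r ?nnegrE ?addr_ge0 ?L2_norm_ge0 //.
  have := L2_norm_lin p_gt0 1 hv hK; rewrite normr1 mul1r -qv; exact.
rewrite normrM ger0_norm // ler_pM2l //.
exact: (L2_cauchy_schwarz p_gt0).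
Unshelve. all: by end_near. Qed.

Lemma solution_decay (c : R) (z0 : nat -> R) (z : R -> nat -> R) :
  form_ge c -> is_solution p K z0 z ->
  forall t : R, 0 <= t -> L2_norm p (z t) <= expR (- c * t) * L2_norm p z0.
Proof.
move=> hc sz; have [z00 hz _] := sz.
(* Negative times carry no information about [z], so the energy is extended by its value at 0. *)
pose N (s : R) := <|z (Num.max s 0), z (Num.max s 0)|>.
pose g (s : R) := expR (s * (2 * c)) * N s.
have dN (s : R) : 0 < s -> is_derive s (1 : R) N (2 * <|K (z s), z s|>).
  move=> s0; have := solution_derive sz (ltW s0).
  have sp : \forall h \near (0 : R)^', 0 <= s + h.
    apply: nbhs_dnbhs; exists s => //= h; rewrite /ball_ /= sub0r normrN ltr_norml.
    by move=> /andP[hs _]; lra.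
  move=> hcv.
  have cv : h^-1 *: ((N \o shift s) (h *: 1) - N s) @[h --> (0 : R)^'] --> 2 * <|K (z s), z s|>.
    move=> A hA.
    have hA' : \forall h \near (0 : R)^', 0 <= s + h ->
      A (h^-1 * (<|z (s + h), z (s + h)|> - <|z s, z s|>)) := hcv A hA.
    apply: filterS2 sp hA' => h sh /(_ sh).
    by rewrite /= /N /GRing.scale /= mulr1 (addrC h) !max_l // (ltW s0).
  by apply: DeriveDef; [apply/cvg_ex; exists (2 * <|K (z s), z s|>)|exact/cvg_lim].
have dg (s : R) : 0 < s -> is_derive s (1 : R) g
    (expR (s * (2 * c)) * (2 * (c * <|z s, z s|> + <|K (z s), z s|>))).
  move=> s0; have := dN s s0 => dNs.
  apply: is_derive_eq; rewrite /N /GRing.scale /= max_l ?(ltW s0) //; ring.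
have g_le t : 0 <= t -> g t <= g 0.
  move=> t0; apply: (@ler0_derive1_nincry _ g 0 _ _ _ 0 t _ t0); last exact: lexx.
  - by move=> s; rewrite in_itv /= andbT => s0; have [] := dg s s0.
  - move=> s; rewrite in_itv /= andbT => s0; rewrite derive1E.
    rewrite (@derive_val _ _ _ _ _ _ _ (dg s s0)).
    rewrite pmulr_rle0 ?expR_gt0 // pmulr_rle0 //.
    by rewrite -lerBrDr sub0r; apply: form_geL2 => //; exact: hz (ltW s0).
  - apply/continuous_within_itvcyP; split.
      move=> s; rewrite in_itv /= andbT => s0.
      by apply: differentiable_continuous; apply/derivable1_diffP; have [] := dg s s0.
    apply: cvgM.
      apply: cvg_at_right_filter.
      by apply: continuous_comp; [exact: mulrr_continuous|exact: continuous_expR].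
    (* Right continuity at 0: the energy is its initial value plus [h] times a convergent one-sided
       difference quotient. *)
    have := solution_derive sz (lexx 0); rewrite /N => hcv.
    have id0 : h @[h --> within [set h | 0 <= 0 + h] (0 : R)^'] --> (0 : R).
      by apply: cvg_within_filter; exact: nbhs_dnbhs.
    have := cvgD (cvgM id0 hcv) (cvg_cst <|z 0, z 0|>).
    rewrite mul0r add0r maxxx => hcv2.
    have le0 : (0 : R)^'+ `=>` within [set h | 0 <= 0 + h] (0 : R)^'.
      move=> P hP; near=> h; have h0 : 0 < h by near: h; exact: nbhs_right_gt.
      have hPh : h != 0 -> 0 <= 0 + h -> P h.
        by near: h; apply: (@cvg_within _ _ _ (fun u => 0 < u)); exact: hP.
      by apply: hPh; rewrite ?gt_eqF ?add0r ?ltW.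
    apply: cvg_trans (cvg_trans (cvg_app _ le0) (hcv2 _ _ _)).
    apply: near_eq_cvg; near=> h.
    have h0 : 0 < h by near: h; exact: nbhs_right_gt.
    change (h * (h^-1 * (<|z (0 + h), z (0 + h)|> - <|z 0, z 0|>)) + <|z 0, z 0|> =
      <|z (Num.max h 0), z (Num.max h 0)|>).
    by rewrite add0r max_l ?(ltW h0) // mulrA divff ?gt_eqF // mul1r subrK.
move=> t t0; have := g_le t t0.
rewrite /g /N !max_l // mul0r expR0 mul1r z00 => gle.
have h0 : L2 p z0 by rewrite -z00; exact: hz.
apply: (L2_norm_le p_gt0); first by rewrite mulr_ge0 ?expR_ge0 ?L2_norm_ge0.
  exact: hz.
rewrite exprMn (L2_norm_sqr p_gt0) //.
rewrite -(ler_pM2l (expR_gt0 (t * (2 * c)))); apply: le_trans gle _.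
rewrite [leRHS](_ : _ = expR (t * (2 * c) + (- c * t + - c * t)) * <|z0, z0|>); last first.
  by rewrite !expRD; ring.
by rewrite (_ : t * (2 * c) + (- c * t + - c * t) = 0) ?expR0 ?mul1r //; ring.
Unshelve. all: by end_near. Qed.

End Decay.

(** * Hardy inequality *)

Section Poincare.
Context {R : realType} (beta rho : R) (L : nat).
Hypotheses (beta_gt0 : 0 < beta) (rho_gt0 : 0 < rho) (rho_lt1 : rho < 1).
Hypothesis L_gt0 : (0 < L)%N.
Implicit Types x : nat -> R.

Local Notation p := (weight rho L).
Local Notation K := (opK beta rho L).
Local Notation r k := (L%:R * rho ^+ (L ^ k)).
Local Notation psum x y n := (\sum_(1 <= k < n) x k * y k / p k).
Local Notation en x n := (\sum_(1 <= k < n.+1) p k * (x k / p k - x k.-1 / p k.-1) ^+ 2).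

Let p_gt0 := weight_gt0 rho_gt0 L_gt0.
Let p_neq0 k : p k != 0. Proof. by rewrite gt_eqF. Qed.
Let L_neq0 : L%:R != 0 :> R. Proof. by rewrite pnatr_eq0 -lt0n. Qed.
Let rhoX_neq0 m : rho ^+ m != 0. Proof. by rewrite expf_neq0 ?gt_eqF. Qed.

(** Keeping the boundary term for arbitrary [x] allows induction on the cut-off. *)
Lemma opK_energy x n : x 0%N = 0 -> - psum (K x) x n.+1 =
  beta * en x n - beta * p n.+1 * (x n / p n) * (x n.+1 / p n.+1 - x n / p n).
Proof.
move=> x0; elim: n => [|n IH].
  by rewrite !big_geq // x0 !(mul0r, mulr0) subrr oppr0.
rewrite big_nat_recr // [in RHS]big_nat_recr //= opprD IH.
case: n {IH} => [|n].
  rewrite x0 big_geq // !weight_recr //; field.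
  by rewrite !p_neq0 !rhoX_neq0 L_neq0.
rewrite !weight_recr //; field.
by rewrite !p_neq0 !rhoX_neq0 L_neq0.
Qed.

Lemma opK_form x n : x 0%N = 0 -> (forall k, (n <= k)%N -> x k = 0) ->
  - psum (K x) x n = beta * en x n.
Proof.
case: n => [|n] x0 xn; first by rewrite !big_geq // mulr0 oppr0.
(* As [x] vanishes from [n + 1] on, the boundary term is exactly the last summand of the energy. *)
rewrite opK_energy // [in RHS]big_nat_recr //= (xn n.+1) //; ring.
Qed.

Lemma form_ge0 : form_ge beta rho L 0.
Proof.
move=> x n x0 xn; rewrite mul0r opK_form // mulr_ge0 ?(ltW beta_gt0) // sumr_ge0 // => k _.
by rewrite mulr_ge0 ?sqr_ge0 // ltW.
Qed.

Let termE x k : x k * x k / p k = p k * (x k / p k) ^+ 2.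
Proof. by field. Qed.

Let sqr_term_ge0 x k : 0 <= x k * x k / p k.
Proof. by rewrite termE mulr_ge0 ?sqr_ge0 // ltW. Qed.

Let step_le x k : p k.+2 * (x k.+1 / p k.+1) ^+ 2 <= L%:R * (x k.+1 * x k.+1 / p k.+1).
Proof.
rewrite termE mulrA ler_wpM2r ?sqr_ge0 // weight_recr // ler_pM2r //.
exact: ratio_le.
Qed.

Lemma opK_form_le x n : x 0%N = 0 -> (forall k, (n <= k)%N -> x k = 0) ->
  - psum (K x) x n <= beta * (2 * (1 + L%:R)) * psum x x n.
Proof.
move=> x0 xn; rewrite opK_form // -mulrA ler_pM2l //.
(* Edge by edge, [(u - v)^2 <= 2 u^2 + 2 v^2]. The last coordinate is charged only for the edge on
   its left; [step_le] pays for the edge on its right at the next step. *)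
suff H m : en x m <= 2 * (1 + L%:R) * psum x x m + 2 * (x m * x m / p m).
  by have := H n; rewrite (xn n (leqnn n)) mulr0 mul0r mulr0 addr0.
elim: m => [|m IH]; first by rewrite !big_geq // x0 !(mulr0, mul0r) addr0.
case: m IH => [|m] IH.
  rewrite big_nat1 big_geq //= x0 mul0r subr0 mulr0 add0r -termE.
  by rewrite ler_peMl ?sqr_term_ge0 // ler1n.
rewrite [leLHS]big_nat_recr // [in leRHS]big_nat_recr //=.
have := step_le x m; have := sqr_term_ge0 x m.+2; move: IH.
rewrite !(termE x m.+1) !(termE x m.+2).
set u := x m.+2 / _; set v := x m.+1 / _ => IH _ h2.
have h : (u - v) ^+ 2 <= 2 * u ^+ 2 + 2 * v ^+ 2 by have := sqr_ge0 (u + v); lra.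
have := ler_wpM2l (ltW (p_gt0 m.+2)) h.
lra.
Qed.

(** For [L >= 2] one has [L^k >= k + 1], so the ratio is at most [rho * (L * rho^k)], and [rho^k]
    drops below [1 / L]. *)
Lemma ratio_eventually_le : exists N, forall k, (N <= k)%N -> r k <= rho.
Proof.
have [L1|L1] := eqVneq L 1%N.
  by exists 0%N => k _; rewrite L1 exp1n expr1 mul1r.
have L2 : (1 < L)%N by case: (L) L_gt0 L1 => [|[]].
have rho1 : `|rho| < 1 by rewrite gtr0_norm.
have Linv : 0 < (L%:R)^-1 :> R by rewrite invr_gt0 ltr0n.
have /cvgr0Pnorm_le/(_ _ Linv)[N _ hN] := cvg_expr rho1.
exists N => k Nk; have := hN k Nk; rewrite /= ger0_norm ?exprn_ge0 ?(ltW rho_gt0) // => hk.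
have : rho ^+ (L ^ k) <= rho ^+ k.+1.
  by rewrite ler_wiXn2l ?(ltW rho_gt0) ?(ltW rho_lt1) // ltn_expl.
move=> /(ler_wpM2l (ler0n R L))/le_trans; apply.
rewrite exprS mulrCA ler_piMr ?(ltW rho_gt0) //.
by rewrite -ler_pdivlMl ?ltr0n // mulr1.
Qed.

(* The weights [a] of the Hardy inequality: constant and small once the ratio
   of consecutive values of [p] has dropped below [rho], and growing
   geometrically backwards from there. *)
Lemma hardy_weights : exists (a : nat -> R) (c : R), 0 < c /\
  forall k, 0 <= a k <= 2^-1 /\ c <= a k - r k * (a k.+1 * (1 + 2 * a k.+1)).
Proof.
have quarter : (1 - rho) / 4 <= 2^-1 by have := rho_gt0; lra.
have [N rN] := ratio_eventually_le.
(* For [k < N], [B * a k.+1] covers the loss, at most [2 * L * a k.+1], and leaves [a k.+1] over. *)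
pose B : R := 2 * L%:R + 1.
have B1 : 1 <= B by rewrite /B; have := ler0n R L; lra.
have BX m : 1 <= B ^+ m by rewrite exprn_ege1.
(* Normalized so that the largest weight [a0 * B ^+ N] equals [(1 - rho) / 4]. *)
pose a0 : R := (1 - rho) / (4 * B ^+ N).
have BN0 : 0 < B ^+ N by exact: lt_le_trans (BX N).
have a0_gt0 : 0 < a0 by rewrite divr_gt0 ?subr_gt0 // mulr_gt0.
have a0B : a0 * B ^+ N = (1 - rho) / 4 by rewrite /a0; field; rewrite gt_eqF.
pose a (k : nat) : R := a0 * B ^+ (N - k).
have a0_le k : a0 <= a k by rewrite ler_peMr // ltW.
have a_le k : a k <= (1 - rho) / 4.
  by rewrite -a0B ler_pM2l // ler_weXn2l // leq_subr.
have aS k : (k < N)%N -> a k = B * a k.+1.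
  by move=> kN; rewrite /a -subSS subSn // exprS mulrCA.
have aE j : (N <= j)%N -> a j = a0.
  by rewrite /a -subn_eq0 => /eqP ->; rewrite expr0 mulr1.
clearbody a; clearbody a0.
(* Where the weights are constant, the linear part leaves [a0 * (1 - rho)], and the quadratic part
   takes at most half of it. *)
exists a, (a0 * (1 - rho) / 2); split.
  by rewrite divr_gt0 // mulr_gt0 // subr_gt0.
move=> k; have := a0_le k; have := a_le k; have := a0_le k.+1; have := a_le k.+1.
move=> h1 h2 h3 h4; split.
  by rewrite (le_trans (ltW a0_gt0) h4) (le_trans h3 quarter).
have [kN|Nk] := ltnP k N.
  have rL : r k <= L%:R by exact: ratio_le.
  have r0 : 0 <= r k by exact: ratio_ge0.
  have : r k * (a k.+1 * (1 + 2 * a k.+1)) <= L%:R * (a k.+1 * 2).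
    apply: ler_pM => //; first by rewrite mulr_ge0; lra.
    by apply: ler_wpM2l; lra.
  rewrite (aS k kN) /B; nra.
have rk := rN k Nk; have ha0 : a0 <= (1 - rho) / 4 by rewrite -(aE k Nk).
rewrite !aE ?(leqW Nk) //.
have : r k * (a0 * (1 + 2 * a0)) <= rho * (a0 * (1 + 2 * a0)).
  by rewrite ler_wpM2r //; rewrite mulr_ge0 //; lra.
have : a0 * (rho * a0) <= a0 * (1 * ((1 - rho) / 4)).
  by have := rho_gt0; have := rho_lt1 => *; rewrite ler_pM2l //; apply: ler_pM; lra.
lra.
Qed.

Lemma form_ge_gt0 : exists2 c : R, 0 < c & form_ge beta rho L c.
Proof.
have [a [c [c0 ac]]] := hardy_weights; exists (beta * c); first exact: mulr_gt0.
move=> x n x0 xn; rewrite opK_form // -mulrA ler_pM2l //.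
(* The extra term [a m * (x m)^2 / p m] is the reserve passed from one edge to the next; it vanishes
   beyond the support. *)
suff H m : c * psum x x m + a m * (x m * x m / p m) <= en x m.
  by have := H n; rewrite (xn n (leqnn n)) !(mulr0, mul0r) addr0.
elim: m => [|m IH]; first by rewrite !big_geq // x0 !(mulr0, mul0r) addr0.
case: m IH => [|m] IH.
  rewrite big_nat1 big_geq //= x0 mul0r subr0 mulr0 add0r -termE.
  by rewrite ler_piMl ?sqr_term_ge0 //; have [/andP[_ h] _] := ac 1%N; lra.
rewrite [leRHS]big_nat_recr // [in leLHS]big_nat_recr //=.
have [_ ha] := ac m.+1; have [/andP[b0 b1] _] := ac m.+2.
move: IH; rewrite !(termE x m.+1) !(termE x m.+2).
set u := x m.+2 / _; set v := x m.+1 / _ => IH.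
set b := a m.+2 in ha b0 b1 *.
(* Completing the square in [u] gives the sharp coefficient [b / (1 - b)] of [v^2], which is at most
   [b * (1 + 2 * b)] for [b <= 1/2]. *)
have h1 : b * u ^+ 2 - b * (1 + 2 * b) * v ^+ 2 <= (u - v) ^+ 2.
  rewrite -subr_ge0 -(pmulr_rge0 _ (_ : 0 < 1 - b)); last lra.
  have -> : (1 - b) * ((u - v) ^+ 2 - (b * u ^+ 2 - b * (1 + 2 * b) * v ^+ 2)) =
    ((1 - b) * u - v) ^+ 2 + b ^+ 2 * (1 - 2 * b) * v ^+ 2 by ring.
  by rewrite addr_ge0 ?sqr_ge0 // mulr_ge0 ?sqr_ge0 // mulr_ge0 ?sqr_ge0 //; lra.
have := ler_wpM2l (ltW (p_gt0 m.+2)) h1.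
have := ler_wpM2r (mulr_ge0 (ltW (p_gt0 m.+1)) (sqr_ge0 v)) ha.
move: IH; rewrite !weight_recr //.
lra.
Qed.

End Poincare.

(** * The Karlin-McGregor measure *)

Section Spectral.
Context {R : realType} (beta rho : R) (L : nat).
Hypotheses (beta_gt0 : 0 < beta) (rho_gt0 : 0 < rho) (rho_lt1 : rho < 1).
Hypothesis L_gt0 : (0 < L)%N.
Implicit Types (x : nat -> R) (f g q : {poly R}).

Local Notation p := (weight rho L).
Local Notation K := (opK beta rho L).
Local Notation Q := (KMpoly beta rho L).
Local Notation psum x y n := (\sum_(1 <= k < n) x k * y k / p k).

Let p_gt0 := weight_gt0 rho_gt0 L_gt0.
Let p_neq0 k : p k != 0. Proof. by rewrite gt_eqF. Qed.

Lemma form_ge_le_beta c : form_ge beta rho L c -> c <= beta.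
Proof.
move=> hc; have [N rN] := ratio_eventually_le rho_gt0 rho_lt1 L_gt0.
(* The energy of this test sequence sits on the two end edges only. Taking [n = N + 1] makes [p 1]
   and [p n.+1] distinct summands of the norm. *)
pose n := N.+1; pose x k := if (0 < k <= n.+1)%N then p k else 0.
have x0 : x 0%N = 0 by [].
have xn k : (n.+2 <= k)%N -> x k = 0 by move=> nk; rewrite /x (leqNgt k) nk andbF.
have xE k : (0 < k <= n.+1)%N -> x k / p k = 1.
  by move=> kn; rewrite /x kn divff.
have := hc x n.+2 x0 xn; rewrite opK_form //.
have -> : \sum_(1 <= k < n.+3) p k * (x k / p k - x k.-1 / p k.-1) ^+ 2 = p 1 + p n.+2.
  rewrite big_nat_recr //= big_ltn // big_nat big1 => [|k /andP[k1 kn]].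
    rewrite xE // x0 mul0r subr0 expr1n mulr1 addr0 (xn n.+2) // mul0r sub0r.
    by rewrite xE ?leqnn // sqrrN expr1n mulr1.
  rewrite xE ?(ltnW k1) // xE ?subrr ?expr2 ?mulr0 //.
  by rewrite -ltnS prednK ?(ltnW k1) // k1 /= (leq_trans (leq_pred _)).
have -> : psum x x n.+2 = \sum_(1 <= k < n.+2) p k.
  rewrite !big_nat; apply: eq_bigr => k /andP[k1 kn].
  have kk : (0 < k <= n.+1)%N by rewrite k1.
  by rewrite -mulrA xE // mulr1 /x kk.
(* Past [N] the weights decrease, so [p n.+2] is at most [p n.+1], and the two end edges weigh no
   more than the norm. *)
have pn : p 1 + p n.+2 <= \sum_(1 <= k < n.+2) p k.
  rewrite big_nat_recr // big_ltn //= -addrA lerD2l.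
  apply: (@le_trans _ _ (p n.+1)); last by rewrite lerDr sumr_ge0 // => k _; exact: ltW.
  rewrite weight_recr // ler_piMl ?(ltW (p_gt0 _)) //.
  by apply: le_trans (ltW rho_lt1); apply: rN; rewrite /n !leqW.
have S0 : 0 < \sum_(1 <= k < n.+2) p k by apply: lt_le_trans pn; rewrite addr_gt0.
move=> h; rewrite -(ler_pM2r S0); apply: le_trans h _.
by rewrite ler_pM2l.
Qed.

(** The recurrence of the [Q k] is the transpose of [K], so multiplication by ['X] acts on
    coefficients as [-K]; the last two terms are the overflow at the cut-off. *)
Lemma mulX_expansion x n : x 0%N = 0 ->
  'X * (\sum_(1 <= k < n.+1) x k *: Q k) =
  \sum_(1 <= k < n.+1) (- K x k) *: Q k +
  (beta * x n.+1) *: Q n - (beta * L%:R * rho ^+ (L ^ n) * x n) *: Q n.+1.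
Proof.
move=> x0; have XQ m : 'X * Q m.+1 = - (beta *: Q m) +
    (beta * L%:R * rho ^+ (L ^ m.+1) + beta) *: Q m.+1 -
    (beta * L%:R * rho ^+ (L ^ m.+1)) *: Q m.+2.
  have := KMpoly_rec (n := m.+1) beta_gt0 rho_gt0 L_gt0 isT.
  by move=> /(congr1 -%R); rewrite opprK => ->; rewrite !opprD opprK.
have Q0 : Q 0 = 0 by [].
move: Q Q0 XQ => q q0 XQ; elim: n => [|n IH].
  by rewrite !big_geq // x0 q0 !mulr0 scale0r scaler0 addr0 subrr.
rewrite big_nat_recr // mulrDr IH [in RHS]big_nat_recr //= -scalerAr XQ.
rewrite -!mul_polyC !(polyCD, polyCN, polyCM); ring.
Qed.

(** One coefficient sequence serves every upper limit [m >= n], so the cut-off can be moved past the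
    support at will. *)
Definition in_span f := exists n x, [/\ x 0%N = 0, forall k, (n <= k)%N -> x k = 0 &
  forall m, (n <= m)%N -> f = \sum_(1 <= k < m) x k *: Q k].

(** Induction on [f * 'X + c]: the factor ['X] acts as [-K], and [c] enters at index 1 because
    [Q 1 = 1]. *)
Lemma poly_in_span f : in_span f.
Proof.
elim/poly_ind: f => [|f c [n [x [x0 xn fE]]]].
  exists 0%N, (fun=> 0); split=> // m _; by rewrite big1 // => k _; rewrite scale0r.
exists n.+2, (fun k => - K x k + c * (k == 1%N)%:R); split=> [|[|k] // kn|[|m] // mn].
- by rewrite /= oppr0 add0r mulr0.
- have nk : (n <= k)%N := ltnW kn.
  rewrite /= (xn _ nk) (xn _ (leqW nk)) (xn _ (leqW (leqW nk))).
  by rewrite gtn_eqF ?(leq_ltn_trans _ kn) //=; ring.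
have nm : (n <= m)%N := ltnW mn.
rewrite {1}(fE _ (leqW nm)) mulrC mulX_expansion // (xn _ nm) (xn _ (leqW nm)).
rewrite !mulr0 !scale0r addr0 subr0.
under [RHS]eq_bigr do rewrite scalerDl.
rewrite big_split /=; congr (_ + _).
rewrite big_ltn ?(leq_ltn_trans _ mn) // big_nat big1 => [|k /andP[k1 _]].
  by rewrite eqxx mulr1 addr0 -mul_polyC mulr1.
by rewrite gtn_eqF // mulr0 scale0r.
Qed.

(** * Integration of polynomials against the measure *)

Variable psi : probability (measurableTypeR R) R.
Hypothesis psiKM : KM_measure beta rho L psi.

Local Notation D := [set t : R | 0 <= t].
Definition KMint q : R := \int[psi]_(t in D) q.[t].
Local Notation I := KMint.

Let mD : measurable (D : set (measurableTypeR R)).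
Proof. by rewrite -set_itvcy; exact: measurable_itv. Qed.

Let mlt (c : R) : measurable ([set t : R | t < c] : set (measurableTypeR R)).
Proof. by rewrite -set_itvNyo; exact: measurable_itv. Qed.

Let mpoly (A : set (measurableTypeR R)) q :
  measurable_fun A (fun t : measurableTypeR R => (q.[t])%:E).
Proof.
apply/measurable_EFinP; apply: measurable_funTS.
by apply: continuous_measurable_fun; exact: continuous_horner.
Qed.

(** Squares [Q k ^ 2] are nonnegative with finite integral, hence integrable; they dominate the
    mixed products, and every polynomial is a combination of the [Q k * Q 1]. *)
Let integrable_poly q : psi.-integrable D (fun t => (q.[t])%:E).
Proof.
have QQ i j : (1 <= i)%N -> (1 <= j)%N -> psi.-integrable D (fun t => ((Q i * Q j).[t])%:E).
  move=> i1 j1.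
  have sq k : (1 <= k)%N -> psi.-integrable D (fun t => ((Q k * Q k).[t])%:E).
    move=> k1; apply/integrableP; split; first exact: mpoly.
    under eq_integral do rewrite hornerM gee0_abs ?lee_fin -?expr2 ?sqr_ge0 // expr2.
    by rewrite psiKM.2 // ltry.
  apply: (le_integrable mD (g := fun t => ((Q i * Q i).[t] + (Q j * Q j).[t])%:E)).
  - exact: mpoly.
  - move=> t _; rewrite /= lee_fin !hornerM.
    set a := (Q i).[t]; set b := (Q j).[t].
    rewrite [leRHS]ger0_norm; last by rewrite -!expr2 addr_ge0 ?sqr_ge0.
    rewrite ler_norml; have := sqr_ge0 (a + b); have := sqr_ge0 (a - b).
    by have := sqr_ge0 a; have := sqr_ge0 b => *; apply/andP; split; nra.
  - exact: (integrableD mD (sq i i1) (sq j j1)).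
have [n [x [_ _ /(_ n (leqnn n)) ->]]] := poly_in_span q.
have -> : (fun t => ((\sum_(1 <= k < n) x k *: Q k).[t])%:E) =
    (fun t => (\sum_(1 <= k < n) (x k)%:E * ((Q k * Q 1).[t])%:E)%E).
  apply/funext => t; rewrite horner_sum -sumEFin; apply: eq_bigr => k _.
  by rewrite -EFinM hornerZ hornerM hornerC mulr1.
apply: integrable_sum => // k _; apply: integrableZl => //.
case: k => [|k]; last exact: QQ.
have -> : (fun t : measurableTypeR R => ((Q 0 * Q 1).[t])%:E) = cst 0%E.
  by apply/funext => t; rewrite mul0r horner0.
exact: integrable0.
Qed.

Lemma KMint_lin c f g : I (c *: f + g) = c * I f + I g.
Proof.
have ic : psi.-integrable D (EFin \o (fun t => c * f.[t])).
  have -> : EFin \o (fun t => c * f.[t]) = (fun t => ((c *: f).[t])%:E).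
    by apply/funext => t; rewrite /= hornerZ.
  exact: integrable_poly.
rewrite /KMint -(RintegralZl c mD (integrable_poly f)).
rewrite -(RintegralD mD ic (integrable_poly g)).
by apply: eq_Rintegral => t _; rewrite hornerD hornerZ.
Qed.

Lemma KMint0 : I 0 = 0.
Proof.
by have := KMint_lin (-1) 0 0; rewrite scaler0 addr0 mulN1r addNr.
Qed.

Lemma KMintD f g : I (f + g) = I f + I g.
Proof. by have := KMint_lin 1 f g; rewrite scale1r mul1r. Qed.

Lemma KMintZ c f : I (c *: f) = c * I f.
Proof. by have := KMint_lin c f 0; rewrite KMint0 !addr0. Qed.

Lemma KMint_sum (u : nat -> {poly R}) n :
  I (\sum_(1 <= k < n) u k) = \sum_(1 <= k < n) I (u k).
Proof. exact: (big_morph I KMintD KMint0). Qed.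

Lemma KMint_QQ i j : (1 <= i)%N -> (1 <= j)%N ->
  I (Q i * Q j) = if i == j then (p i)^-1 else 0.
Proof.
move=> i1 j1; rewrite /KMint /Rintegral.
by under eq_integral do rewrite hornerM; rewrite psiKM.2.
Qed.

Lemma KMint_pair (u v : nat -> R) n :
  I ((\sum_(1 <= k < n) u k *: Q k) * (\sum_(1 <= k < n) v k *: Q k)) = psum u v n.
Proof.
rewrite mulr_suml KMint_sum; apply: eq_big_nat => i /andP[i1 ilt].
rewrite -scalerAl KMintZ mulr_sumr KMint_sum -mulrA; congr (_ * _).
rewrite (bigD1_seq i) /= ?mem_index_iota ?i1 ?iota_uniq //.
rewrite big_nat_cond big1 => [|j /andP[/andP[j1 _] ji]].
  by rewrite -scalerAr KMintZ KMint_QQ // eqxx addr0.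
by rewrite -scalerAr KMintZ KMint_QQ // eq_sym (negbTE ji) mulr0.
Qed.

(** Carries bounds for the form of [K] to integrals against [psi]; [KMint_form_of] goes the other
    way. *)
Lemma KMint_form f : exists n x, [/\ x 0%N = 0, forall k, (n <= k)%N -> x k = 0,
  I (f * f) = psum x x n & I ('X * (f * f)) = - psum (K x) x n].
Proof.
have [n [x [x0 xn fE]]] := poly_in_span f; exists n.+1, x; split=> //.
- by move=> k nk; rewrite xn // ltnW.
- by rewrite [in LHS](fE n.+1) // KMint_pair.
- rewrite mulrA [in LHS](fE n.+1) // mulX_expansion // (xn n) // (xn n.+1) //.
  rewrite !mulr0 !scale0r addr0 subr0 KMint_pair -sumrN.
  by apply: eq_bigr => k _; rewrite !mulNr.
Qed.

Lemma KMint_form_of x n : x 0%N = 0 -> (forall k, (n <= k)%N -> x k = 0) ->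
  exists f, I (f * f) = psum x x n /\ I ('X * (f * f)) = - psum (K x) x n.
Proof.
move=> x0 xn; exists (\sum_(1 <= k < n.+1) x k *: Q k); split.
  rewrite KMint_pair; case: n xn => [|n] xn; first by rewrite !big_geq.
  by rewrite big_nat_recr //= (xn n.+1) // mulr0 mul0r addr0.
rewrite mulrA mulX_expansion // (xn n) // (xn n.+1) //.
rewrite !mulr0 !scale0r addr0 subr0 KMint_pair.
under eq_bigr do rewrite !mulNr; rewrite sumrN; congr (- _).
case: n xn => [|n] xn; first by rewrite !big_geq.
by rewrite big_nat_recr //= (xn n.+1) // mulr0 mul0r addr0.
Qed.

Lemma KMint_ge0 q : (forall t, 0 <= t -> 0 <= q.[t]) -> 0 <= I q.
Proof. by move=> q0; apply: Rintegral_ge0. Qed.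

Lemma KMint_null_ge0 c q : psi [set t | t < c] = 0%E ->
  (forall t, c <= t -> 0 <= q.[t]) -> 0 <= I q.
Proof.
move=> c0 q0; rewrite /KMint /Rintegral.
rewrite (negligible_integral (mlt c) mD (integrable_poly q) c0).
apply: fine_ge0; apply: integral_ge0 => t [_ /= tc].
by rewrite lee_fin q0 // leNgt; apply/negP.
Qed.

Lemma null_form_ge c : psi [set t | t < c] = 0%E -> form_ge beta rho L c.
Proof.
move=> c0 x n x0 xn; have [f [<- <-]] := KMint_form_of x0 xn.
rewrite -subr_ge0 -KMintZ -mulN1r -KMintZ -KMintD.
apply: (KMint_null_ge0 c0) => t ct.
rewrite hornerD !hornerZ mulN1r hornerM hornerX -mulrBl mulr_ge0 ?subr_ge0 //.
by rewrite hornerM -expr2 sqr_ge0.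
Qed.

Lemma KMint_form_ge c f : form_ge beta rho L c -> c * I (f * f) <= I ('X * (f * f)).
Proof.
by move=> hc; have [n [x [x0 xn -> ->]]] := KMint_form f; exact: hc.
Qed.

Lemma KMint_form_le f : I ('X * (f * f)) <= beta * (2 * (1 + L%:R)) * I (f * f).
Proof.
have [n [x [x0 xn -> ->]]] := KMint_form f.
exact: (opK_form_le beta_gt0 rho_gt0 rho_lt1 L_gt0).
Qed.

Lemma KMint1 : I 1 = 1.
Proof.
have -> : (1 : {poly R}) = Q 1 * Q 1 by rewrite /= mulr1.
rewrite KMint_QQ // eqxx /weight /geom_exponent expn1 subnn div0n.
by case: ifP => _; rewrite !expr0 mulr1 invr1.
Qed.

(* The even moments of [M - X] at the centre [M] of an interval [c, d]
   containing the spectrum grow like powers of its half-length, since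
   (d-c)(X-c)(d-X) = (X-c)(d-X)^2 + (d-X)(X-c)^2; Chebyshev's inequality then
   excludes mass to the left of [c]. *)
Lemma form_ge_null c c' : form_ge beta rho L c -> c' < c ->
  psi [set t | t < c'] = 0%E.
Proof.
(* [c + 1] only ensures that the interval from [c] to [d] is not degenerate. *)
move=> hc c'c; pose d := Num.max (beta * (2 * (1 + L%:R))) (c + 1).
have cd : c < d by rewrite lt_max ltrDl ltr01 orbT.
have I_sqr f : 0 <= I (f * f).
  by apply: KMint_ge0 => t _; rewrite hornerM -expr2 sqr_ge0.
have hd f : I ('X * (f * f)) <= d * I (f * f).
  by apply: le_trans (KMint_form_le f) _; rewrite ler_wpM2r // le_max lexx.
pose M := (c + d) / 2; pose r := (d - c) / 2.
pose h : {poly R} := M%:P - 'X.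
have mom n : I (h ^+ n * h ^+ n) <= (r ^+ n) ^+ 2.
  elim: n => [|n IH]; first by rewrite !expr0 mul1r expr1n KMint1.
  rewrite (exprS h) (exprS r) exprMn; apply: le_trans (ler_wpM2l (sqr_ge0 r) IH).
  move: (h ^+ n) => f {IH}.
  have h1 := KMint_form_ge ((d%:P - 'X) * f) hc.
  have h2 := hd (('X - c%:P) * f).
  (* Since [r^2 - h^2 = (X - c)(d - X)], this is the decomposition of [(d - c) r^2 f^2] into
     [(d - c) h^2 f^2] and two parts that the form bounds make nonnegative. *)
  have E : I (((d - c) * r ^+ 2) *: (f * f)) =
     I ((d - c) *: (h * f * (h * f))) +
     (I ('X * ((d%:P - 'X) * f * ((d%:P - 'X) * f))) +
      I ((- c) *: ((d%:P - 'X) * f * ((d%:P - 'X) * f)))) +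
     (I (d *: (('X - c%:P) * f * (('X - c%:P) * f))) +
      I ((- 1) *: ('X * (('X - c%:P) * f * (('X - c%:P) * f))))).
    rewrite -!KMintD; congr (I _).
    rewrite /h -!mul_polyC.
    have -> : M%:P = r%:P + c%:P.
      by rewrite -polyCD; congr polyC; rewrite /M /r; field.
    have -> : d%:P = r%:P * 2%:P + c%:P.
      by rewrite -polyCM -polyCD; congr polyC; rewrite /r; field.
    have -> : d - c = 2 * r by rewrite /r; field.
    by rewrite !(polyCM, polyCN, polyC_exp) polyC1; ring.
  move: E; rewrite !KMintZ => E.
  rewrite -(ler_pM2l (_ : 0 < d - c)) ?subr_gt0 // [leRHS]mulrA E.
  lra.
pose A := D `&` [set t | t < c'].
have mA : measurable (A : set (measurableTypeR R)) by apply: measurableI; [exact: mD|exact: mlt].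
have c'M : c' < M by rewrite /M; lra.
have r0 : 0 < r by rewrite divr_gt0 // subr_gt0.
have rM : r < M - c' by rewrite /r /M; lra.
have Mc0 : 0 < M - c' by exact: lt_trans rM.
(* To the left of [c'] the distance to the centre exceeds [M - c'], which is larger than [r]; large
   [n] then leaves no mass there. *)
have cheb n : ((((M - c') ^+ n) ^+ 2)%:E * psi A <= ((r ^+ n) ^+ 2)%:E)%E.
  rewrite -integral_cst //.
  apply: (@le_trans _ _ (\int[psi]_(t in D) ((h ^+ n * h ^+ n).[t])%:E)%E).
    apply: (@le_trans _ _ (\int[psi]_(t in A) ((h ^+ n * h ^+ n).[t])%:E)%E).
      apply: ge0_le_integral => //.
      - by move=> t _; rewrite lee_fin sqr_ge0.
      - move=> t [_ /= tc']; rewrite lee_fin hornerM -expr2.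
        rewrite horner_exp /h hornerD hornerN hornerC hornerX.
        by rewrite !lerXn2r ?nnegrE ?exprn_ge0 ?lerD2l ?lerN2 ?(ltW tc') //; lra.
    apply: ge0_subset_integral => //.
      by move=> t _; rewrite lee_fin hornerM -expr2 sqr_ge0.
    by move=> t [].
  rewrite -(fineK (integrable_fin_num mD (integrable_poly _))) lee_fin.
  exact: mom.
have A0 : psi A = 0%E.
  have fA : psi A \is a fin_num by exact: fin_num_measure.
  rewrite -(fineK fA); congr EFin; apply/eqP; rewrite eq_le fine_ge0 // andbT.
  pose th := (r / (M - c')) ^+ 2.
  have th1 : `|th| < 1.
    rewrite ger0_norm ?sqr_ge0 //.
    have q0 : 0 <= r / (M - c') by rewrite divr_ge0 ?ltW.
    have q1 : r / (M - c') < 1 by rewrite ltr_pdivrMr ?mul1r.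
    by rewrite /th expr2 mulr_ilt1.
  have pn n : fine (psi A) <= th ^+ n.
    have := cheb n; rewrite -{1}(fineK fA) -EFinM lee_fin => hn.
    rewrite /th -exprM mulnC exprM expr_div_n expr_div_n.
    by rewrite ler_pdivlMr ?exprn_gt0 // mulrC.
  rewrite -(cvg_lim (@Rhausdorff R) (cvg_expr th1)).
  apply: limr_ge; first by apply/cvg_ex; exists 0; exact: cvg_expr.
  exact: nearW.
apply: (@subset_measure0 _ _ _ psi _ ([set t | t < 0] `|` A)) => //.
- by apply: measurableU; [exact: mlt|exact: mA].
- by move=> t /= tc'; case: (ltP t 0) => t0; [left|right].
- exact: (etrans (measureU0 (mu := psi) (mlt 0) mA A0) psiKM.1).
Qed.

Lemma spectral_bottom : exists gamma : R,
  [/\ is_min (measure_support psi) gamma, 0 < gamma <= beta &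
      form_ge beta rho L gamma].
Proof.
pose S := [set c : R | psi [set t : R | t < c] = 0%E].
have S0 : S 0 by exact: psiKM.1.
have S_le c : S c -> c <= beta by move=> /null_form_ge /form_ge_le_beta.
have supS : has_sup S by split; [exists 0|exists beta => c /S_le].
pose gamma := sup S.
have near_sup e : 0 < e -> exists2 c, S c & gamma - e < c.
  by move=> e0; exact: sup_adherent.
exists gamma; split.
- split=> [U oU Ug|x xS].
    rewrite lt0e measure_ge0 andbT; apply/eqP => U0.
    have [e /= e0 eU] := (nbhs_ballP gamma U).1 (open_nbhs_nbhs (conj oU Ug)).
    have [c Sc ec] := near_sup e e0.
    (* A null neighbourhood of [gamma], joined to a null half-line ending within [e] of it, would
       push [S] beyond its supremum. *)
    have : S (gamma + e).
      apply: (@subset_measure0 _ _ _ psi _ ([set t | t < c] `|` U)) => //.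
      + by apply: measurableU; [exact: mlt|exact: open_measurable].
      + move=> t /= te; case: (ltP t c) => tc; [by left|right; apply: eU].
        by rewrite /ball /= ltr_distlC; apply/andP; split; lra.
      + exact: (etrans (measureU0 (mu := psi) (mlt c) (open_measurable oU) U0) Sc).
    by move=> /(sup_upper_bound supS); rewrite -/gamma gerDl leNgt e0.
  rewrite leNgt; apply/negP => xg.
  have [c Sc] := near_sup (gamma - x) (ltac:(by rewrite subr_gt0)).
  rewrite subKr => xc.
  have oc : open [set t : R | t < c] by exact: open_lt.
  by have := xS _ oc xc; rewrite Sc ltxx.
- apply/andP; split; last by apply: ge_sup => [|c /S_le //]; exists 0.
  have [c c0 hc] := form_ge_gt0 beta_gt0 rho_gt0 rho_lt1 L_gt0.
  (* [form_ge_null] needs a number strictly below [c]; half of it is still positive. *)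
  have Sc : S (c / 2) by apply: (form_ge_null hc); lra.
  by apply: lt_le_trans (sup_upper_bound supS Sc); rewrite divr_gt0.
- move=> x n x0 xn.
  have P0 : 0 <= psum x x n.
    by rewrite sumr_ge0 // => k _; rewrite -expr2 divr_ge0 ?sqr_ge0 // ltW.
  have [Pz|Pn0] := eqVneq (psum x x n) 0.
    by rewrite Pz mulr0; have := null_form_ge S0 x0 xn; rewrite mul0r.
  have Pp : 0 < psum x x n by rewrite lt_neqAle eq_sym Pn0.
  (* Every [c] in [S] is a lower bound of the Rayleigh quotient, hence so is the supremum. *)
  rewrite -ler_pdivlMr //; apply: ge_sup; first by exists 0.
  by move=> c Sc; rewrite ler_pdivlMr //; exact: null_form_ge.
Qed.

End Spectral.

(** * Uniqueness and conclusion *)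

Lemma solution_sub (R : realType) (p : nat -> R) (A : (nat -> R) -> nat -> R)
    (z0 : nat -> R) (z z' : R -> nat -> R) :
  (forall k, 0 < p k) -> bounded_operator p A ->
  is_solution p A z0 z -> is_solution p A z0 z' ->
  is_solution p A (fun=> 0) (fun t k => z' t k - z t k).
Proof.
move=> p_gt0 [LA linA _] [z00 hz dz] [z00' hz' dz'].
have sub_eq (x y : nat -> R) : (fun k => x k - y k) = (fun k => -1 * y k + x k).
  by apply/funext => k; ring.
split.
- by apply/funext => k; rewrite z00 z00' subrr.
- by move=> t t0; apply: L2_sub; [|exact: hz'|exact: hz].
move=> t t0; have [hA nA cA] := dz t t0; have [hA' nA' cA'] := dz' t t0.
have AE : A (fun k => z' t k - z t k) = (fun k => A (z' t) k - A (z t) k).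
  by rewrite !sub_eq linA //; [exact: hz|exact: hz'].
rewrite AE; split; first exact: L2_sub.
  apply: filterS2 nA nA' => h h1 h2.
  have -> : (fun k => h^-1 * (z' (t + h) k - z (t + h) k - (z' t k - z t k))) =
    (fun k => h^-1 * (z' (t + h) k - z' t k) - h^-1 * (z (t + h) k - z t k)).
    by apply/funext => k; ring.
  exact: L2_sub.
have := cvgD cA cA'; rewrite addr0 => cs.
apply: (squeeze_cvgr (f := fun=> 0) _ (cvg_cst 0) (cs _)).
apply: filterS2 nA nA' => h h1 h2; rewrite L2_norm_ge0 /=.
set u := (fun k => h^-1 * (z (t + h) k - z t k) - A (z t) k).
set v := (fun k => h^-1 * (z' (t + h) k - z' t k) - A (z' t) k).
have -> : (fun k => h^-1 * (z' (t + h) k - z (t + h) k - (z' t k - z t k)) -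
    (A (z' t) k - A (z t) k)) = (fun k => -1 * u k + v k).
  by apply/funext => k; rewrite /u /v; ring.
apply: le_trans (L2_norm_lin p_gt0 _ _ _) _; [exact: L2_sub|exact: L2_sub|].
by rewrite normrN1 mul1r.
Qed.

Theorem theorem2p9 (R : realType) (alpha beta rho : R) (L : nat)
    (alpha_gt0 : 0 < alpha) (alpha_lt_beta : alpha < beta)
    (rhoE : rho = alpha / beta) (L_ge1 : (1 <= L)%N) :
  let p := weight rho L in
  let K := opK beta rho L in
  [/\ bounded_operator p K /\ selfadjoint_operator p K,
      forall z0 : nat -> R, L2 p z0 ->
        exists z : R -> nat -> R,
          [/\ forall t : R, 0 <= t -> is_exp_operator p K t z0 (z t),
              is_solution p K z0 z &
              forall z' : R -> nat -> R, is_solution p K z0 z' ->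
                forall t : R, 0 <= t -> z' t = z t] &
      forall psi : probability (measurableTypeR R) R,
        KM_measure beta rho L psi ->
        exists gamma : R,
          [/\ is_min (measure_support psi) gamma,
              0 < gamma <= beta &
              forall (z0 : nat -> R) (z : R -> nat -> R),
                L2 p z0 -> is_solution p K z0 z ->
                forall t : R, 0 <= t ->
                  L2_norm p (z t) <= expR (- gamma * t) * L2_norm p z0]].
Proof.
have beta_gt0 : 0 < beta by exact: lt_trans alpha_lt_beta.
have rho_gt0 : 0 < rho by rewrite rhoE divr_gt0.
have rho_lt1 : rho < 1 by rewrite rhoE ltr_pdivrMr ?mul1r.
move=> p K.
have p_gt0 k : 0 < p k by exact: weight_gt0.
have bK : bounded_operator p K.
  split.
  - by move=> x /(opK_bounded beta_gt0 rho_gt0 rho_lt1 L_ge1)[].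
  - by move=> a x y _ _; exact: opK_lin.
  - by exists (opK_bound beta L) => x /(opK_bounded beta_gt0 rho_gt0 rho_lt1 L_ge1)[].
have decay := solution_decay beta_gt0 rho_gt0 rho_lt1 L_ge1.
split.
- by split=> //; exact: opK_selfadjoint.
- move=> z0 hz0; exists (expK beta rho L z0).
  have sz : is_solution p K z0 (expK beta rho L z0) by exact: expK_solution.
  split=> // [t t0|z' sz' t t0]; first exact: expK_is_exp.
  (* The difference of two solutions starts at 0, and its norm does not grow, by decay at rate 0. *)
  have sd := solution_sub p_gt0 bK sz sz'.
  have := decay _ _ _ (form_ge0 beta_gt0 rho_gt0 L_ge1) sd t t0.
  rewrite [L2_norm p (fun=> 0)]L2_normE L2_inner0 sqrtr0 mulr0 => n0.
  have hd : L2 p (fun k => z' t k - expK beta rho L z0 t k) by case: sd => _ + _; exact.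
  have d0 := L2_norm_sqr p_gt0 hd.
  have nd : L2_norm p (fun k => z' t k - expK beta rho L z0 t k) = 0.
    by apply/eqP; rewrite eq_le n0 L2_norm_ge0.
  rewrite nd expr2 mul0r in d0.
  apply/funext => k; apply/eqP; rewrite -subr_eq0; apply/eqP.
  by have /(congr1 (fun f => f k)) := L2_inner_eq0 p_gt0 hd (esym d0).
- move=> psi hpsi.
  have [gamma [h1 h2 h3]] := spectral_bottom beta_gt0 rho_gt0 rho_lt1 L_ge1 hpsi.
  exists gamma; split=> // z0 z _ sz t t0.
  exact: decay h3 sz t t0.
Qed.
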